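(* For $m\in\{1,\dots,M\}$, $$\lambda_m=\max_{\boldsymbol y\in\mathcal I(\mathcal T^{m-1})}g(\boldsymbol y,\mathcal T^{m-1}),\qquad \mathcal T^m=\mathcal T^{m-1}\setminus\bigcup_{\substack{\boldsymbol y\in\mathcal I(\mathcal T^{m-1}):\\ g(\boldsymbol y,\mathcal T^{m-1})=\lambda_m}}\mathcal D(\mathcal T^{m-1}_{\boldsymbol y}).$$ Moreover, the points of the set $\{(\alpha_m,d_m)\}_{m=1}^M$, with $$\alpha_m=\mathbb P(T(\mathcal T^m)<S),\qquad d_m=\mathbb E\big(T(\mathcal T^m)-S\big)^+,$$ are the break-points of $d(\alpha)$.
   Context: Let $\{(X_i,Y_i)\}_{i\ge1}$ be a discrete-time process where the $X_i$'s and $Y_i$'s take values in finite alphabets $\mathcal X$ and $\mathcal Y$; $Y^n=(Y_1,\dots,Y_n)$. A (possibly randomized) stopping time with respect to $\{X_i\}_{i\ge1}$ is an integer-valued random variable $S$ such that for each $n$ the event $\{S=n\}$, conditioned on $X_1,\dots,X_n$, is independent of $\{X_i\}_{i>n}$; similarly for $\{Y_i\}_{i\ge1}$. Let $S$ be a stopping time with respect to $\{X_i\}_{i\ge1}$ with positive integer values and $S\le\kappa$ almost surely for some constant $\kappa\ge1$. For $\alpha\in[0,1]$, $$d(\alpha)=\min_{T:\ \mathbb P(T<S)\le\alpha,\ T\le\kappa}\mathbb E(T-S)^+,$$ the minimum being over possibly randomized stopping times $T$ with respect to $\{Y_i\}_{i\ge1}$. The function $d$ is convex and piecewise linear; ''break-points''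 refers to this piecewise linear curve. Trees are finite $|\mathcal Y|$-ary trees: nodes are labelled by finite strings over $\mathcal Y$ (the root is the empty string, the children of $\boldsymbol y$ are $\boldsymbol y\gamma$, $\gamma\in\mathcal Y$), every node having $0$ or exactly $|\mathcal Y|$ children. $\mathcal L(\mathcal T)$ and $\mathcal I(\mathcal T)$ are the sets of leaves and of intermediate (non-terminal) nodes; $\mathcal T_{\boldsymbol y}$ is the subtree of $\mathcal T$ rooted in $\boldsymbol y$, and $\mathcal D(\mathcal T_{\boldsymbol y})$ is the set of (strict) descendants of $\boldsymbol y$ in $\mathcal T$. $T(\mathcal T)$ is the non-randomized stopping time with respect to $\{Y_i\}_{i\ge1}$ induced by $\mathcal T$, which stops at the first $n$ for which $Y^n$ is a leaf of $\mathcal T$. For a string $\boldsymbol y$ of length $n$ and $\lambda\ge0$ set $$a(\boldsymbol y)=\mathbb P(Y^n=\boldsymbol y)\,\mathbb P(S>n\mid Y^n=\boldsymbol y),\quad b(\boldsymbol y)=\mathbb P(Y^n=\boldsymbol y)\,\mathbb E\big((n-S)^+\mid Y^n=\boldsymbol y\big),\quad J_\lambda(\boldsymbol y)=b(\boldsymbol y)+\lambda a(\boldsymbol y)$$ (these being $0$ if $\mathbb P(Y^n=\boldsymbol y)=0$). For a tree $\mathcal T'$ rooted at any node, $a(\mathcal T')$, $b(\mathcal T')$, $J_\lambda(\mathcal T')$ are the sums of $a$, $b$, $J_\lambda$ over $\mathcal L(\mathcal T')$. For $\boldsymbol y\in\mathcal I(\mathcal T)$, $$g(\boldsymbol y,\mathcal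 T)=\frac{b(\mathcal T_{\boldsymbol y})-b(\boldsymbol y)}{a(\boldsymbol y)-a(\mathcal T_{\boldsymbol y})},$$ where $0/0$ is set equal to $0$. $\mathcal T(\lambda)$ is the smallest optimal subtree of $\mathcal T$ with the same root: $J_\lambda(\mathcal T(\lambda))\le J_\lambda(\mathcal T')$ for all subtrees $\mathcal T'\subset\mathcal T$ with the same root, and $\mathcal T(\lambda)\subset\mathcal T'$ whenever equality holds (such a tree always exists). It is increasing in $\lambda$; for $\lambda=\infty$ it is read as $\mathcal T(\lambda)$ for all sufficiently large finite $\lambda$. Let $\mathcal T^0$ be the complete $|\mathcal Y|$-ary tree of depth $\kappa$ and $\lambda_0=\infty$. For $m=1,\dots,M$ define recursively $$\lambda_m=\inf\{\lambda\le\lambda_{m-1}:\ \mathcal T^{m-1}(\lambda)=\mathcal T^{m-1}\},\qquad \mathcal T^m=\mathcal T^{m-1}(\lambda_m)$$ (over $\lambda\ge0$), where $M$ is the smallest integer such that $\lambda_{M+1}=0$, and with $\lambda_1=\infty$ if the set over which the infimum is taken is empty.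
   Formalization: For m=1 the two formulas assume that each null string shorter than κ extends a positive-probability string at which S has occurred a.s.; (0,d(0)) counts as a break-point iff λ_1=∞; the randomization of T must also be independent of the X_i and S. *)

(* Defs.v *)
From HB Require Import structures.
From mathcomp Require Import all_boot all_order all_algebra finmap.
From mathcomp Require Import all_classical all_reals all_analysis.

Set Implicit Arguments.
Unset Strict Implicit.
Unset Printing Implicit Defensive.

Import Order.TTheory GRing.Theory Num.Theory.
Import numFieldNormedType.Exports.

Local Open Scope classical_set_scope.
Local Open Scope ring_scope.

(* Processes are indexed from 0: the variable written
   X_i (i >= 1) in the mathematics is [X i.-1] here, so that
   Z^n = (Z_1, ..., Z_n) is [past Z n] and (Z_i)_(i > n) is [Z i], i >= n. *)

Definition past {Omega A : Type} (Z : nat -> Omega -> A) (n : nat) (w : Omega) :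
  seq A := mkseq (fun i => Z i w) n.

Section StoppingTimes.
Context {R : realType} {d : measure_display} {Omega : measurableType d}.
Variable P : probability Omega R.

Definition pr (E : set Omega) : R := fine (P E).

(* By [x / 0 = 0], both conditional quantities are 0 when [pr F = 0]. *)
Definition cond_pr (E F : set Omega) : R := pr (E `&` F) / pr F.

Definition cond_exp (f : Omega -> R) (F : set Omega) : R :=
  Rintegral P F f / pr F.

Definition past_is {A : Type} (Z : nat -> Omega -> A) (z : seq A) :
  set Omega := [set w | past Z (size z) w = z].

Definition future_events {A : Type} (Z : nat -> Omega -> A) (n : nat) :
  set (set Omega) :=
  [set E | exists i x, (n <= i)%N /\ E = [set w | Z i w = x]].

(* [T] is a possibly randomized stopping time with respect to [Z]: the event
   {T = n}, conditioned on Z_1, ..., Z_n, is independent of (Z_i)_(i > n) and,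
   jointly, of the events in [V].  The plain notion is [V = set0]; a nonempty
   [V] lists quantities that the randomization of [T] must not look at.
   Independence given an event [F] is written without division as
   P(E1, E2, F) P(F) = P(E1, F) P(E2, F), a void condition if P(F) = 0. *)
Definition stopping_time {A : Type} (Z : nat -> Omega -> A)
    (V : set (set Omega)) (T : Omega -> nat) : Prop :=
  (forall n, measurable [set w | T w = n]) /\
  forall (z : seq A) (E : set Omega),
    <<s future_events Z (size z) `|` V >> E ->
    let F := past_is Z z in
    let Tn := [set w | T w = size z] in
    pr (Tn `&` E `&` F) * pr F = pr (Tn `&` F) * pr (E `&` F).

Definition early (T S : Omega -> nat) : R := pr [set w | (T w < S w)%N].

(* Subtraction on [nat] is truncated: this is E (T - S)^+. *)
Definition delay (T S : Omega -> nat) : R :=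
  fine 'E_P[fun w => ((T w - S w)%N)%:R].

End StoppingTimes.

Section Trees.
Local Open Scope fset_scope.
Context {B : finType}.

(* A tree is the set of its nodes; the children of [y] are the [rcons y c]. *)
Definition tree := {fset seq B}.

Definition is_tree (T : tree) : Prop :=
  [::] \in T /\
  forall y c, rcons y c \in T -> y \in T /\ forall c', rcons y c' \in T.

Definition leaves (T : tree) : tree :=
  [fset y in T | [forall c, rcons y c \notin T]].

Definition inner (T : tree) : tree := T `\` leaves T.

Definition subtree_at (T : tree) (y : seq B) : tree :=
  [fset z in T | prefix y z].

Definition descendants (T : tree) (y : seq B) : tree :=
  subtree_at T y `\ y.

Definition complete_tree (k : nat) : tree :=
  [fset bseqval s | s : {: k.-bseq B}].

(* Length of the first prefix of the sequence that is a leaf of [T]; the search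
   may stop at the height of [T]. *)
Definition tree_stop {Omega : Type} (Y : nat -> Omega -> B) (T : tree)
    (w : Omega) : nat :=
  find (fun n => past Y n w \in leaves T) (iota 0 (\max_(y <- T) size y).+1).

End Trees.
Arguments tree B : clear implicits.
Arguments complete_tree B k : clear implicits.

Section Tradeoff.
Context {R : realType} {d : measure_display} {Omega : measurableType d}.
Context {A B : finType}.
Variables (P : probability Omega R).
Variables (X : nat -> Omega -> A) (Y : nat -> Omega -> B).
Variables (S : Omega -> nat) (kappa : nat).

(* [feasible alpha v]: some randomized stopping time T <= kappa with respect to
   (Y_i) has P(T < S) <= alpha and E (T - S)^+ = v.  Since the given space may
   be too small to carry the randomization, T lives on an extension
   [p : Omega' -> Omega] of it.  The randomization is private: given Y^n, the
   event {T = n} is independent of (Y_i)_(i > n) jointly with (X_i) and S.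
   Independence of (Y_i)_(i > n) alone would let T copy S whenever S is
   independent of Y. *)
Definition feasible (alpha v : R) : Prop :=
  exists (d' : measure_display) (Omega' : measurableType d')
         (P' : probability Omega' R) (p : Omega' -> Omega) (T : Omega' -> nat),
    let X' := fun i => X i \o p in
    let Y' := fun i => Y i \o p in
    let S' := S \o p in
    [/\ measurable_fun setT p /\
          (forall E, measurable E -> P' (p @^-1` E) = P E),
        stopping_time P' Y'
          (future_events X' 0 `|`
             [set E | exists s, E = [set w | S' w = s]]) T,
        forall w, (T w <= kappa)%N,
        early P' T S' <= alpha
      & delay P' T S' = v].

(* The minimum itself, not just the infimum. *)
Definition min_delay (alpha : R) : R :=
  xget 0 [set v | feasible alpha v /\ lbound (feasible alpha) v].

Definition cost_a (y : seq B) : R :=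
  pr P (past_is Y y) *
  cond_pr P [set w | (size y < S w)%N] (past_is Y y).

Definition cost_b (y : seq B) : R :=
  pr P (past_is Y y) *
  cond_exp P (fun w => ((size y - S w)%N)%:R) (past_is Y y).

Definition cost_J (l : R) (y : seq B) : R := cost_b y + l * cost_a y.

Definition tree_a (T : tree B) : R := \sum_(y <- leaves T) cost_a y.
Definition tree_b (T : tree B) : R := \sum_(y <- leaves T) cost_b y.
Definition tree_J (l : R) (T : tree B) : R := \sum_(y <- leaves T) cost_J l y.

(* On [\bar R], 0 / 0 = 0 and x / 0 = +oo for x > 0. *)
Definition g (y : seq B) (T : tree B) : \bar R :=
  ((tree_b (subtree_at T y) - cost_b y)%:E /
   (cost_a y - tree_a (subtree_at T y))%:E)%E.

Definition subtree (T' T : tree B) : Prop := is_tree T' /\ (T' `<=` T)%fset.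

Definition smallest_optimal (l : R) (T T' : tree B) : Prop :=
  subtree T' T /\
  forall T'', subtree T'' T ->
    tree_J l T' <= tree_J l T'' /\
    (tree_J l T' = tree_J l T'' -> (T' `<=` T'')%fset).

(* The tree T(l) for 0 <= l <= +oo. *)
Definition prune (T : tree B) (l : \bar R) : tree B :=
  match l with
  | r%:E%E => xget T [set T' | smallest_optimal r T T']
  | +oo%E => xget T [set T' | \forall r \near +oo, smallest_optimal r T T']
  | -oo%E => T
  end.

(* The pair (lambda_m, T^m).  The infimum of the empty set is [+oo]. *)
Fixpoint pruning (m : nat) : \bar R * tree B :=
  if m is m'.+1 then
    let: (l, T) := pruning m' in
    let l' := ereal_inf [set x | (0 <= x <= l)%E /\ prune T x = T] in
    (l', prune T l')
  else (+oo%E, complete_tree B kappa).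

Definition lambda (m : nat) : \bar R := (pruning m).1.
Definition ptree (m : nat) : tree B := (pruning m).2.

(* The node [y] is an instance of 0/0 in the complete tree exactly when
   P(Y^n = y) = 0.  Such a node is removed by T(l) for every l whereas
   g = 0 there, so the first pruning step is given by the values of g if and
   only if each such node lies below a node at which S has already occurred
   almost surely (where g = +oo).  This holds in particular if
   P(Y^n = y) > 0 for all y of length n < kappa. *)
Definition null_nodes_settled : Prop :=
  forall y : seq B, (size y < kappa)%N -> pr P (past_is Y y) = 0 ->
  exists z, [/\ prefix z y, 0 < pr P (past_is Y z) & cost_a z = 0].

End Tradeoff.

Section BreakPoints.
Context {R : realType}.

Definition locally_affine_at (f : R -> R) (x : R) : Prop :=
  exists p q, \forall z \near x, f z = p + q * z.

(* Break-points of the piecewise linear curve of [f] on [0, 1], where [s] is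
   the slope, in absolute value and possibly infinite, with which the curve
   enters its left end-point: the end-point is a break-point iff [s = +oo],
   that is, iff the curve starts with a vertical segment. *)
Definition break_points (f : R -> R) (s : \bar R) : set (R * R) :=
  [set p | p.2 = f p.1 /\
     ((0 < p.1 < 1 /\ ~ locally_affine_at f p.1) \/ (p.1 = 0 /\ s = +oo%E))].

End BreakPoints.

(* Main.v *)
(* Write F_y for the event Y^n = y, n = |y|.  Splitting the node y changes the
   leaf sum of a by -P(F_y, S = n+1) and that of b by P(F_y, S <= n).  Hence
   J_l of a tree is a constant plus a sum over its inner nodes of a term that
   decreases in l: J_l is modular on the lattice of subtrees, so that smallest
   optimal subtrees exist and increase with l.  As T is refined by the leaves
   of any subtree U, J_l(U) - J_l(T) is the sum over these leaves y of
   l (a(y) - a(T_y)) - (b(T_y) - b(y)).  Therefore T(l) = T iff g(y, T) < l at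
   all inner y, and at l = max g the smallest optimal subtree cuts T below the
   maximizers of g.

   A randomized stopping time T stops at y with a conditional probability that
   does not depend on (X, S) nor on the future of Y, so backward induction along
   the complete tree bounds E (T - S)^+ + l P(T < S) from below by min J_l.
   Consecutive trees of the pruning sequence are both optimal at the level l
   that separates them, and randomizing between them attains the bound: the
   curve is affine with slope -lambda_m between alpha_(m-1) and alpha_m, and it
   vanishes after alpha_M.  These slopes are distinct because T^m, being its own
   smallest optimal subtree at lambda_m, remains so slightly below lambda_m. *)

(* Degenerate nodes shape the two ends of the sequence. If P(F_y, S > n) = 0 at an inner node y of
   the complete tree, no refinement below y can lower a: for large l the node is cut or not
   according to b alone, and the first level is +oo. [reduces_a] isolates this case. It can concern
   the first step only, because every later tree is its own smallest optimal subtree at a level that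
   it has already reached. At the other end, (alpha_M, 0) is a kink inside the open interval only if
   alpha_M < 1. This comes from comparing T^M, at a positive level, with a tree that never stops
   after S and stops at S with positive probability.

   Null events also decide the form of the statements. Conditional probabilities are compared after
   multiplying by the probabilities of the conditioning events, and ratios g through their
   numerators and denominators. Division takes place only where positivity is known. *)
Require Import Defs.
From HB Require Import structures.
From mathcomp Require Import all_boot all_order all_algebra finmap.
From mathcomp Require Import all_classical all_reals all_analysis measurable_realfun.
From mathcomp Require Import ring lra.

Set Implicit Arguments.
Unset Strict Implicit.
Unset Printing Implicit Defensive.

Import Order.TTheory GRing.Theory Num.Theory.
Import numFieldNormedType.Exports.

Local Open Scope classical_set_scope.
Local Open Scope ring_scope.

(** * Trees *)

Section TreeTheory.
Local Open Scope fset_scope.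
Context {B : finType}.
Implicit Types (T U : tree B) (x y z s : seq B).

Lemma rcons_prefix x y c : prefix x (rcons y c) = (x == rcons y c) || prefix x y.
Proof.
apply/idP/idP.
- move=> /prefixP[[|e t]]; first by rewrite cats0 => ->; rewrite eqxx.
  elim/last_ind: t e => [|t e' _] e.
    by rewrite cats1 => /rcons_inj[-> _]; rewrite prefix_refl orbT.
  rewrite -rcons_cons -rcons_cat => /rcons_inj[-> _].
  by rewrite prefix_prefix orbT.
- case/orP => [/eqP ->|]; first exact: prefix_refl.
  by move=> /prefix_trans; apply; exact: prefix_rcons.
Qed.

Lemma tree_prefix T x y : is_tree T -> prefix x y -> y \in T -> x \in T.
Proof.
move=> [_ hT]; elim/last_ind: y => [|y c IH].
  by rewrite prefixs0 => /eqP ->.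
rewrite rcons_prefix => /orP[/eqP -> //|/IH h] /hT[/h].
by [].
Qed.

Lemma tree_nil T : is_tree T -> [::] \in T.
Proof. by case. Qed.

Lemma leavesP T y :
  reflect (y \in T /\ forall c, rcons y c \notin T) (y \in leaves T).
Proof.
rewrite !inE /=; apply: (iffP andP) => -[yT h]; split=> //; first exact/forallP.
exact/forallP.
Qed.

Lemma leaves_in T y : y \in leaves T -> y \in T.
Proof. by case/leavesP. Qed.

Lemma innerP T y : is_tree T ->
  reflect (y \in T /\ exists c, rcons y c \in T) (y \in inner T).
Proof.
move=> hT; rewrite in_fsetD; apply: (iffP andP).
- move=> [nl yT]; split=> //; apply/existsP; rewrite -[X in is_true X]negbK negb_exists.
  apply: contra nl => /forallP h; exact/leavesP.
- move=> [yT [c cT]]; split=> //; apply/leavesP => -[_ /(_ c)].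
  by rewrite cT.
Qed.

Lemma inner_in T y : y \in inner T -> y \in T.
Proof. by rewrite in_fsetD => /andP[]. Qed.

Lemma inner_leaf T y : y \in T -> (y \in inner T) = (y \notin leaves T).
Proof. by move=> yT; rewrite in_fsetD yT andbT. Qed.

Lemma inner_child T y c : is_tree T -> y \in inner T -> rcons y c \in T.
Proof.
move=> hT /(innerP _ hT)[yT [c' c'T]].
by case: hT => _ /(_ _ _ c'T)[_ /(_ c)].
Qed.

Lemma inner_parent T y c : is_tree T -> rcons y c \in T -> y \in inner T.
Proof.
move=> hT h; apply/innerP => //; split; last by exists c.
exact: (tree_prefix hT (prefix_rcons y c)).
Qed.

Lemma inner_prefix T x y : is_tree T -> prefix x y -> y \in T -> x != y ->
  x \in inner T.
Proof.
move=> hT; elim/last_ind: y => [|y c IH].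
  by rewrite prefixs0 => /eqP ->; rewrite eqxx.
rewrite rcons_prefix => /orP[/eqP ->|pxy cT _]; first by rewrite eqxx.
have yi := inner_parent hT cT.
have [-> //|xy] := eqVneq x y.
by apply: IH => //; exact: inner_in.
Qed.

Lemma inner_prefix_inner T x y : is_tree T -> prefix x y -> y \in inner T ->
  x \in inner T.
Proof.
move=> hT pxy yi; have [-> //|xy] := eqVneq x y.
exact: inner_prefix hT pxy (inner_in yi) xy.
Qed.

Lemma inner_sub T U : is_tree T -> is_tree U -> U `<=` T -> inner U `<=` inner T.
Proof.
move=> hT hU /fsubsetP sUT; apply/fsubsetP => y /(innerP _ hU)[yU [c cU]].
by apply/innerP => //; split; [exact: sUT|exists c; exact: sUT].
Qed.

Lemma is_treeI T U : is_tree T -> is_tree U -> is_tree (T `&` U).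
Proof.
move=> [nT hT] [nU hU]; split; first by rewrite in_fsetI nT.
move=> y c; rewrite in_fsetI => /andP[/hT[yT cT] /hU[yU cU]].
by split=> [|c']; rewrite in_fsetI ?yT ?yU // cT cU.
Qed.

Lemma is_treeU T U : is_tree T -> is_tree U -> is_tree (T `|` U).
Proof.
move=> [nT hT] [nU hU]; split; first by rewrite in_fsetU nT.
move=> y c; rewrite in_fsetU => /orP[/hT[yT cT]|/hU[yU cU]].
  by split=> [|c']; rewrite in_fsetU ?yT // cT.
by split=> [|c']; rewrite in_fsetU ?yU ?orbT // cU orbT.
Qed.

Lemma innerI T U : is_tree T -> is_tree U -> inner (T `&` U) = inner T `&` inner U.
Proof.
move=> hT hU; have hI := is_treeI hT hU.
apply/fsetP => y; rewrite in_fsetI; apply/idP/andP.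
- move=> yI; split.
    exact: (fsubsetP (inner_sub hT hI (fsubsetIl _ _))).
  exact: (fsubsetP (inner_sub hU hI (fsubsetIr _ _))).
- move=> [/[dup] yT /(innerP _ hT)[y1 [c cT]] yU].
  apply/innerP => //; rewrite in_fsetI y1 (inner_in yU); split=> //.
  by exists c; rewrite in_fsetI cT inner_child.
Qed.

Lemma innerU T U : is_tree T -> is_tree U -> inner (T `|` U) = inner T `|` inner U.
Proof.
move=> hT hU; have hI := is_treeU hT hU.
apply/fsetP => y; rewrite in_fsetU; apply/idP/orP.
- move=> /(innerP _ hI)[_ [c]]; rewrite in_fsetU => /orP[] h; [left|right];
  exact: inner_parent h.
- case; first exact: (fsubsetP (inner_sub hI hT (fsubsetUl _ _))).
  exact: (fsubsetP (inner_sub hI hU (fsubsetUr _ _))).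
Qed.

(** Two prefixes of the same string are comparable, and a proper prefix of a node is inner. *)
Lemma leaf_prefix_uniq T s x y : is_tree T -> prefix x s -> prefix y s ->
  x \in leaves T -> y \in leaves T -> x = y.
Proof.
move=> hT; wlog : x y / (size x <= size y)%N.
  move=> h xs ys xl yl; case: (leqP (size x) (size y)) => [|/ltnW] xy; first exact: h.
  by apply/esym; exact: h.
move=> sxy xs ys xl yl.
have pxy : prefix x y.
  move: xs ys; rewrite !prefixE => /eqP xs /eqP ys.
  by rewrite -ys take_takel // xs.
apply/eqP; apply/negPn/negP => xy.
by have := inner_prefix hT pxy (leaves_in yl) xy; rewrite in_fsetD xl.
Qed.

(** Shortening [s] from the right until it enters [T] ends at a leaf. Together with
    [leaf_prefix_uniq], the leaves partition the strings that are not inner. *)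
Lemma leaf_prefix_ex T s : is_tree T -> s \notin inner T ->
  exists2 y, y \in leaves T & prefix y s.
Proof.
move=> hT; elim/last_ind: s => [|s c IH] h.
  by exists [::] => //; move: h; rewrite (inner_leaf (tree_nil hT)) negbK.
have [cT|cT] := boolP (rcons s c \in T).
  by exists (rcons s c); [move: h; rewrite inner_leaf // negbK|exact: prefix_refl].
have /IH [y yl py] : s \notin inner T.
  by apply: contra cT => ?; exact: inner_child.
by exists y => //; rewrite rcons_prefix py orbT.
Qed.

Lemma in_subtree_at T y z : (z \in subtree_at T y) = (z \in T) && prefix y z.
Proof. by rewrite !inE. Qed.

Lemma leaves_subtree_at T y z :
  (z \in leaves (subtree_at T y)) = (z \in leaves T) && prefix y z.
Proof.
apply/leavesP/andP.
- rewrite in_subtree_at => -[/andP[zT yz] h]; split=> //; apply/leavesP; split=> // c.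
  move: (h c); rewrite in_subtree_at rcons_prefix yz orbT andbT.
  by [].
- move=> [/leavesP[zT h] yz]; rewrite in_subtree_at zT yz; split=> // c.
  by rewrite in_subtree_at (negbTE (h c)).
Qed.

Lemma subtree_at_nil T : subtree_at T [::] = T.
Proof. by apply/fsetP => z; rewrite in_subtree_at prefix0s andbT. Qed.

Lemma in_descendants T y z :
  (z \in descendants T y) = [&& z \in T, prefix y z & z != y].
Proof. by rewrite in_fsetD1 in_subtree_at andbC andbA. Qed.

(** The shape of the formula for T^m, with the selection abstracted: [Q] will be a tie between
    excesses, an equation on [g], or a single node. *)
Definition cut_below T (Q : pred (seq B)) : tree B :=
  T `\` \bigcup_(y <- inner T | Q y) descendants T y.

Lemma in_cut T (Q : pred (seq B)) z :
  reflect (z \in T /\ forall y, y \in inner T -> Q y -> prefix y z -> z = y)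
    (z \in cut_below T Q).
Proof.
rewrite in_fsetD; apply: (iffP andP).
- move=> [nz zT]; split=> // y yi Qy yz; apply/eqP/negPn/negP => zy.
  move/negP: nz; apply; apply/bigfcupP; exists y; rewrite ?yi //.
  by rewrite in_descendants zT yz zy.
- move=> [zT h]; split=> //; apply/negP => /bigfcupP[y /andP[yi Qy]].
  by rewrite in_descendants => /and3P[_ yz /eqP zy]; apply/zy/h.
Qed.

Lemma is_tree_cut_below T Q : is_tree T -> is_tree (cut_below T Q).
Proof.
move=> hT; split.
  apply/in_cut; split; first exact: tree_nil.
  by move=> y _ _; rewrite prefixs0 => /eqP ->.
move=> y c /in_cut[cT h]; have yi := inner_parent hT cT.
split=> [|c'].
  apply/in_cut; split; first exact: inner_in.
  move=> w wi Qw wy; have := h w wi Qw.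
  rewrite rcons_prefix wy orbT => /(_ isT) e.
  by move: (size_prefix wy); rewrite -e size_rcons ltnn.
apply/in_cut; split; first exact: inner_child.
move=> w wi Qw; rewrite rcons_prefix => /orP[/eqP //|wy].
have := h w wi Qw; rewrite rcons_prefix wy orbT => /(_ isT) e.
by move: (size_prefix wy); rewrite -e size_rcons ltnn.
Qed.

Lemma cut_sub T Q : cut_below T Q `<=` T.
Proof. exact: fsubsetDl. Qed.

Lemma leaves_cut T Q y : is_tree T -> y \in leaves (cut_below T Q) ->
  y \in leaves T \/ y \in inner T /\ Q y.
Proof.
move=> hT /leavesP[yC hc]; have /in_cut[yT hy] := yC.
have [yi|yi] := boolP (y \in inner T); last first.
  by left; move: yi; rewrite inner_leaf // negbK.
right; split=> //; apply/negPn/negP => nQ.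
have [_ [c cT]] := innerP _ hT yi.
move/negP: (hc c); apply; apply/in_cut; split=> // w wi Qw.
rewrite rcons_prefix => /orP[/eqP //|wy].
by have := hy _ wi Qw wy => e; move: nQ; rewrite e Qw.
Qed.

Lemma mem_complete_tree k y : (y \in complete_tree B k) = (size y <= k)%N.
Proof.
apply/imfsetP/idP => /= [[s _ ->]|h]; first exact: size_bseq.
by exists (Bseq h).
Qed.

Lemma is_tree_complete k : is_tree (complete_tree B k).
Proof.
split; first by rewrite mem_complete_tree.
move=> y c; rewrite mem_complete_tree size_rcons => h; split.
  by rewrite mem_complete_tree ltnW.
by move=> c'; rewrite mem_complete_tree size_rcons.
Qed.

Lemma inner_complete k y : (0 < #|B|)%N ->
  (y \in inner (complete_tree B k)) = (size y < k)%N.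
Proof.
move=> /card_gt0P[c _].
apply/innerP/idP => [|[_ [c']]|h]; first exact: is_tree_complete.
  by rewrite mem_complete_tree size_rcons.
rewrite mem_complete_tree ltnW //; split=> //.
by exists c; rewrite mem_complete_tree size_rcons.
Qed.

End TreeTheory.

(** * Leaf sums as sums over inner nodes *)

Section LeafSums.
Context {R : realType} {B : finType}.
Implicit Types (T U : tree B) (x y z s : seq B) (f : seq B -> R).

Definition leaf_sum f T : R := \sum_(y <- leaves T) f y.

(** The change of the leaf sum of [f] when the leaf [y] is split. *)
Definition increment f y : R := \sum_(c : B) f (rcons y c) - f y.

Lemma leaf_sum_subtree_at f T y :
  leaf_sum f (subtree_at T y) = \sum_(z <- leaves T | prefix y z) f z.
Proof.
rewrite /leaf_sum -[RHS]big_filter; apply: perm_big; apply: uniq_perm.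
- exact: fset_uniq.
- by rewrite filter_uniq // fset_uniq.
- by move=> z; rewrite leaves_subtree_at mem_filter andbC.
Qed.

Lemma perm_inner_leaves T : perm_eq T (inner T ++ leaves T).
Proof.
apply: uniq_perm; first exact: fset_uniq.
  rewrite cat_uniq !fset_uniq /= andbT; apply/hasPn => y yl.
  by apply/negP => yi; move: (inner_leaf (leaves_in yl)); rewrite yi yl.
move=> y; rewrite mem_cat; have [yT|yT] := boolP (y \in T).
  by rewrite inner_leaf // orNb.
by apply/esym/negP => /orP[/inner_in|/leaves_in]; rewrite (negbTE yT).
Qed.

(** The nodes of [T] below [y] are counted twice: as inner nodes and leaves, and as [y] together
    with the children of inner nodes. *)
Lemma leaf_sum_at f T y : is_tree T -> y \in T ->
  leaf_sum f (subtree_at T y) =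
  f y + \sum_(z <- inner T | prefix y z) increment f z.
Proof.
move=> hT yT; rewrite leaf_sum_subtree_at.
have e1 : \sum_(z <- T | prefix y z) f z =
    \sum_(z <- inner T | prefix y z) f z + \sum_(z <- leaves T | prefix y z) f z.
  by rewrite (perm_big _ (perm_inner_leaves T)) big_cat.
have e2 : \sum_(z <- T | prefix y z) f z =
    f y + \sum_(z <- inner T | prefix y z) \sum_(c : B) f (rcons z c).
  rewrite -big_filter.
  pose children :=
    [seq rcons z c | z <- [seq z <- inner T | prefix y z], c <- enum B].
  have -> : \sum_(z <- inner T | prefix y z) \sum_(c : B) f (rcons z c) =
      \sum_(u <- children) f u.
    rewrite big_allpairs_dep -[LHS]big_filter; apply: eq_bigr => z _.
    by rewrite big_enum.
  transitivity (\sum_(u <- y :: children) f u); last by rewrite big_cons.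
  apply: perm_big; apply: uniq_perm.
  - by rewrite filter_uniq // fset_uniq.
  - rewrite cons_uniq allpairs_uniq ?andbT ?enum_uniq ?filter_uniq ?fset_uniq //; last first.
      by move=> [u c] [v e] _ _ /= /rcons_inj[-> ->].
    apply/negP => /allpairsP[[u c] /= []]; rewrite mem_filter => /andP[yu _] _ e.
    by move: (size_prefix yu); rewrite e size_rcons ltnn.
  - move=> z; rewrite mem_filter inE; apply/andP/orP.
    + move=> [yz zT]; have [-> |zy] := eqVneq z y; [by left|right].
      apply/allpairsP; case/lastP: z yz zT zy => [|z c].
        by rewrite prefixs0 => /eqP -> _; rewrite eqxx.
      rewrite rcons_prefix => /orP[/eqP ->|yz cT _]; first by rewrite eqxx.
      exists (z, c); rewrite mem_filter yz mem_enum; split=> //=.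
      exact: inner_parent cT.
    + move=> [/eqP ->|]; first by rewrite prefix_refl.
      move=> /allpairsP[[u c] /= []]; rewrite mem_filter => /andP[yu ui] _ ->.
      by rewrite rcons_prefix yu orbT inner_child.
rewrite /increment big_split /= sumrN addrA -e2 e1.
by rewrite addrAC subrr add0r.
Qed.

Lemma leaf_sumE f T : is_tree T ->
  leaf_sum f T = f [::] + \sum_(z <- inner T) increment f z.
Proof.
move=> hT; rewrite -[in LHS](subtree_at_nil T) leaf_sum_at ?tree_nil //.
by congr (_ + _); apply: eq_bigl => z; rewrite prefix0s.
Qed.

Lemma leaf_sum_refine f T U : is_tree T -> is_tree U -> (U `<=` T)%fset ->
  leaf_sum f T = \sum_(y <- leaves U) leaf_sum f (subtree_at T y).
Proof.
move=> hT hU sUT.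
under [RHS]eq_bigr do rewrite leaf_sum_subtree_at big_mkcond.
rewrite exchange_big /=; apply: eq_big_seq => z zl.
have /(leaf_prefix_ex hU)[y yl yz] : z \notin inner U.
  apply/negP => /(fsubsetP (inner_sub hT hU sUT)).
  by rewrite inner_leaf ?zl // leaves_in.
rewrite (bigD1_seq y) ?fset_uniq //= yz big_seq_cond big1 ?addr0 // => w /andP[wl wy].
case: ifPn => // wz; move: wy; by rewrite (leaf_prefix_uniq hU wz yz wl yl) eqxx.
Qed.

Lemma leaf_sum_leaf f T y : is_tree T -> y \in leaves T ->
  leaf_sum f (subtree_at T y) = f y.
Proof.
move=> hT yl; rewrite leaf_sum_at ?(leaves_in yl) //.
rewrite big_seq_cond big1 ?addr0 // => z /andP[zi yz].
by have := inner_prefix_inner hT yz zi; rewrite in_fsetD yl.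
Qed.

Lemma leaf_sum_modular f T U : is_tree T -> is_tree U ->
  leaf_sum f (T `&` U)%fset + leaf_sum f (T `|` U)%fset = leaf_sum f T + leaf_sum f U.
Proof.
move=> hT hU; rewrite !leaf_sumE ?innerI ?innerU //; try exact: is_treeI; try exact: is_treeU.
rewrite addrACA [RHS]addrACA; congr (_ + _).
set F := increment f.
have split (V W : {fset seq B}) : \sum_(z <- V) F z =
    \sum_(z <- (V `&` W)%fset) F z + \sum_(z <- (V `\` W)%fset) F z.
  rewrite -big_cat; apply: perm_big; apply: uniq_perm; first exact: fset_uniq.
    rewrite cat_uniq !fset_uniq /= andbT; apply/hasPn => y.
    by rewrite in_fsetD in_fsetI => /andP[/negbTE -> ->].
  by move=> y; rewrite mem_cat in_fsetI in_fsetD; case: (y \in W); rewrite ?andbT ?andbF ?orbF.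
rewrite (split (inner T `|` inner U)%fset (inner U)) [X in _ = X + _](split (inner T) (inner U)).
have -> : ((inner T `|` inner U) `&` inner U = inner U)%fset by rewrite fsetIC fsetKUC.
have -> : ((inner T `|` inner U) `\` inner U = inner T `\` inner U)%fset.
  by rewrite fsetDUl fsetDv fsetU0.
by rewrite addrCA addrC -!addrA; congr (_ + _); rewrite addrC.
Qed.

End LeafSums.

(** * Smallest optimal subtrees *)

(** The candidates will be members of a powerset of trees, restricted by a mere [Prop] such as being
    a subtree or being optimal at some level. *)
Lemma exists_minimizer (R : realType) (K : eqType) (s : seq K) (Q : K -> Prop) (F : K -> R) :
  (exists2 x, x \in s & Q x) ->
  exists x, [/\ x \in s, Q x & forall y, y \in s -> Q y -> F x <= F y].
Proof.
elim: s => [[x]//|k s IH] [x0].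
have [[x1 x1s Q1]|no] := pselect (exists2 x, x \in s & Q x).
  move=> _ _; have [|x [xs Qx hx]] := IH; first by exists x1.
  have [[Qk kx]|nk] := pselect (Q k /\ F k <= F x).
    exists k; split=> //; first by rewrite inE eqxx.
    move=> y; rewrite inE => /orP[/eqP -> //|ys Qy].
    exact: le_trans (hx _ ys Qy).
  exists x; split=> //; first by rewrite inE xs orbT.
  move=> y; rewrite inE => /orP[/eqP -> Qk|]; last exact: hx.
  by rewrite leNgt; apply/negP => /ltW ?; apply: nk.
rewrite inE => /orP[/eqP -> Qk|xs Q0]; last by case: no; exists x0.
exists k; split=> //; first by rewrite inE eqxx.
move=> y; rewrite inE => /orP[/eqP -> //|ys Qy].
by case: no; exists y.
Qed.

Section LeafSumOrder.
Context {R : realType} {B : finType}.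
Implicit Types (T U : tree B) (x y z s : seq B) (f : seq B -> R).

Lemma leaf_sumD f1 f2 (l : R) T :
  leaf_sum (fun y => f1 y + l * f2 y) T = leaf_sum f1 T + l * leaf_sum f2 T.
Proof. by rewrite /leaf_sum big_split /= mulr_sumr. Qed.

Lemma leaf_sum_subtree_ge f T y : (forall z, 0 <= increment f z) ->
  is_tree T -> y \in T -> f y <= leaf_sum f (subtree_at T y).
Proof.
move=> hf hT yT; rewrite leaf_sum_at // lerDl.
by apply: sumr_ge0.
Qed.

Lemma leaf_sum_subtree_le f T y : (forall z, increment f z <= 0) ->
  is_tree T -> y \in T -> leaf_sum f (subtree_at T y) <= f y.
Proof.
move=> hf hT yT; rewrite leaf_sum_at // gerDl.
by apply: sumr_le0.
Qed.

Lemma leaf_sum_anti f T U : (forall z, increment f z <= 0) ->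
  is_tree T -> is_tree U -> (U `<=` T)%fset -> leaf_sum f T <= leaf_sum f U.
Proof.
move=> hf hT hU sUT; rewrite (leaf_sum_refine f hT hU sUT).
rewrite /leaf_sum big_seq [X in _ <= X]big_seq; apply: ler_sum => y yl.
apply: leaf_sum_subtree_le => //; exact/(fsubsetP sUT)/leaves_in.
Qed.

End LeafSumOrder.

Section Pruning.
Context {R : realType} {d : measure_display} {Omega : measurableType d}.
Context {B : finType}.
Variables (P : probability Omega R) (Y : nat -> Omega -> B) (S : Omega -> nat).
Local Notation a := (cost_a P Y S).
Local Notation b := (cost_b P Y S).
Local Notation J := (cost_J P Y S).
Hypothesis a_decr : forall y, increment a y <= 0.
Hypothesis b_incr : forall y, 0 <= increment b y.
Implicit Types (T U : tree B) (x y z s : seq B) (l r : R).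
Local Notation sopt := (smallest_optimal P Y S).

Lemma tree_JE l T : tree_J P Y S l T = tree_b P Y S T + l * tree_a P Y S T.
Proof. exact: leaf_sumD. Qed.

Lemma tree_aE T : tree_a P Y S T = leaf_sum a T. Proof. by []. Qed.
Lemma tree_bE T : tree_b P Y S T = leaf_sum b T. Proof. by []. Qed.
Lemma tree_J_leaf_sum l T : tree_J P Y S l T = leaf_sum (J l) T. Proof. by []. Qed.

Lemma subtree_refl T : is_tree T -> subtree T T.
Proof. by move=> hT; split. Qed.

Lemma smallest_optimal_exists l T : is_tree T -> exists U, sopt l T U.
Proof.
move=> hT.
have [|U0 [_ [hU0 sU0] min0]] := exists_minimizer
  (s := fpowerset T) (Q := fun U => subtree U T) (tree_J P Y S l).
  by exists T; [rewrite fpowersetE|exact: subtree_refl].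
have {}min0 U : subtree U T -> tree_J P Y S l U0 <= tree_J P Y S l U.
  by move=> /[dup] sU [_ ?]; apply: min0; rewrite ?fpowersetE.
(* Among the optimal subtrees, one with the fewest nodes is contained in all
   others, since optimality is stable under intersection by modularity. *)
have [|U1 [_ [[hU1 sU1] e1] min1]] := exists_minimizer
  (s := fpowerset T)
  (Q := fun U => subtree U T /\ tree_J P Y S l U = tree_J P Y S l U0)
  (fun U => #|` U|%:R : R).
  by exists U0; rewrite ?fpowersetE.
exists U1; split=> // U [hU sU]; rewrite e1; split; first exact: min0.
move=> e; have hI := is_treeI hU1 hU; have hUU := is_treeU hU1 hU.
have sI : subtree (U1 `&` U)%fset T.
  by split=> //; exact: fsubset_trans (fsubsetIl _ _) sU1.
have sUU : subtree (U1 `|` U)%fset T.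
  by split=> //; rewrite fsubUset sU1.
have m1 := min0 _ sI; have m2 := min0 _ sUU.
have eI : tree_J P Y S l (U1 `&` U)%fset = tree_J P Y S l U0.
  apply/eqP; rewrite eq_le m1 andbT.
  have := leaf_sum_modular (J l) hU1 hU; rewrite -!tree_J_leaf_sum e1 -e => em.
  by rewrite -(lerD2r (tree_J P Y S l (U1 `|` U)%fset)) em lerD2l.
have := min1 (U1 `&` U)%fset; rewrite fpowersetE => /(_ sI.2 (conj sI eI)).
rewrite ler_nat => c; apply/fsetIidPl/eqP.
by rewrite eqEfcard fsubsetIl.
Qed.

Lemma smallest_optimal_uniq l T U1 U2 : sopt l T U1 -> sopt l T U2 -> U1 = U2.
Proof.
move=> [s1 h1] [s2 h2]; have [l12 e12] := h1 _ s2; have [l21 e21] := h2 _ s1.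
have e : tree_J P Y S l U1 = tree_J P Y S l U2 by apply/le_anti; rewrite l12.
by apply/eqP; rewrite eqEfsubset e12 // e21.
Qed.

(** Exchange argument. At [l'], enlarging [U'] to the union does not help, so by modularity
    shrinking [U] to the intersection does not hurt. Lowering the level to [l] favours the
    intersection, whose a is larger; minimality of [U] then puts it inside [U']. *)
Lemma smallest_optimal_mono l l' T U U' : sopt l T U -> sopt l' T U' -> l <= l' ->
  (U `<=` U')%fset.
Proof.
move=> [[hU sU] h] [[hU' sU'] h'] ll'.
have sI : subtree (U `&` U')%fset T.
  by split; [exact: is_treeI|exact: fsubset_trans (fsubsetIl _ _) sU].
have sUU : subtree (U `|` U')%fset T.
  by split; [exact: is_treeU|rewrite fsubUset sU].
have [lI eI] := h _ sI; have [lUU _] := h' _ sUU.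
suff e : tree_J P Y S l U = tree_J P Y S l (U `&` U')%fset.
  exact: fsubset_trans (eI e) (fsubsetIr _ _).
apply/le_anti; rewrite lI /=.
have := leaf_sum_modular (J l') hU hU'; rewrite -!tree_J_leaf_sum.
move: lUU; rewrite !tree_JE => lUU em.
have aI : tree_a P Y S U <= tree_a P Y S (U `&` U')%fset.
  exact: leaf_sum_anti hU (sI.1) (fsubsetIl _ _).
have : 0 <= (l' - l) * (tree_a P Y S (U `&` U')%fset - tree_a P Y S U).
  by apply: mulr_ge0; rewrite subr_ge0.
move: lUU em; lra.
Qed.

Lemma smallest_optimal_restrict l T T' U : sopt l T U -> subtree T' T ->
  (U `<=` T')%fset -> sopt l T' U.
Proof.
move=> [[hU sU] h] [hT' sT'] sU'; split=> // V [hV sV]; apply: h.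
by split=> //; exact: fsubset_trans sT'.
Qed.

(** [b_excess] and [a_excess] are the numerator and denominator of [g]. Comparing [b_excess] with
    [l * a_excess] involves no convention on 0/0. *)
Definition b_excess T y : R := tree_b P Y S (subtree_at T y) - b y.
Definition a_excess T y : R := a y - tree_a P Y S (subtree_at T y).

Lemma b_excess_ge0 T y : is_tree T -> y \in T -> 0 <= b_excess T y.
Proof. by move=> hT yT; rewrite subr_ge0 leaf_sum_subtree_ge. Qed.

Lemma a_excess_ge0 T y : is_tree T -> y \in T -> 0 <= a_excess T y.
Proof. by move=> hT yT; rewrite subr_ge0 leaf_sum_subtree_le. Qed.

Lemma tree_J_sub l T U : is_tree T -> subtree U T ->
  tree_J P Y S l U =
  tree_J P Y S l T + \sum_(y <- leaves U) (l * a_excess T y - b_excess T y).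
Proof.
move=> hT [hU sU]; rewrite [tree_J P Y S l T](leaf_sum_refine _ hT hU sU) -big_split.
apply: eq_bigr => y _ /=; rewrite leaf_sumD /a_excess /b_excess /cost_J.
by rewrite tree_aE tree_bE; ring.
Qed.

Lemma excess_leaf T y : is_tree T -> y \in leaves T ->
  a_excess T y = 0 /\ b_excess T y = 0.
Proof.
move=> hT yl; rewrite /a_excess /b_excess tree_aE tree_bE.
by rewrite !leaf_sum_leaf // !subrr.
Qed.

Lemma gap_ge0 l T U y : is_tree T -> subtree U T ->
  (forall z, z \in inner T -> b_excess T z <= l * a_excess T z) ->
  y \in leaves U -> 0 <= l * a_excess T y - b_excess T y.
Proof.
move=> hT [_ /fsubsetP sU] hle yl.
have yT : y \in T by apply/sU/leaves_in.
have [/hle|] := boolP (y \in inner T); first by rewrite subr_ge0.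
rewrite inner_leaf // negbK => /(excess_leaf hT)[-> ->].
by rewrite mulr0 subr0.
Qed.

Lemma tree_J_le_sub l T U : is_tree T -> subtree U T ->
  (forall y, y \in inner T -> b_excess T y <= l * a_excess T y) ->
  tree_J P Y S l T <= tree_J P Y S l U.
Proof.
move=> hT sU hle; rewrite (tree_J_sub _ hT sU) lerDl big_seq sumr_ge0 // => y.
exact: gap_ge0 hT sU hle.
Qed.

(** Cutting at ties is free. Conversely, for an optimal [U] the nonnegative gaps at its leaves sum
    to zero, so each leaf of [U] that is inner in [T] is a tie, and whatever lies strictly below it
    has been cut. *)
Lemma smallest_optimal_cut l T : is_tree T ->
  (forall y, y \in inner T -> b_excess T y <= l * a_excess T y) ->
  sopt l T (cut_below T (fun y => b_excess T y == l * a_excess T y)).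
Proof.
move=> hT hle; set C := cut_below _ _.
have sC : subtree C T by split; [exact: is_tree_cut_below|exact: cut_sub].
have eC : tree_J P Y S l C = tree_J P Y S l T.
  rewrite (tree_J_sub _ hT sC) big_seq big1 ?addr0 // => y /(leaves_cut hT)[].
    by move=> /(excess_leaf hT)[-> ->]; rewrite mulr0 subr0.
  by move=> [_ /eqP ->]; rewrite subrr.
split=> // U sU; rewrite eC; split; first exact: tree_J_le_sub.
rewrite (tree_J_sub _ hT sU) => /esym/(canRL (addKr _)); rewrite addNr => /eqP.
rewrite big_seq psumr_eq0 => [/allP all0|y]; last exact: gap_ge0 hT sU hle.
have [hU _] := sU.
apply/fsubsetP => z /in_cut[zT hz]; apply/negPn/negP => zU.
have [|y yl yz] := leaf_prefix_ex (s := z) hU; first by apply: contra zU; exact: inner_in.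
have zy : z <> y by move=> e; move: zU; rewrite e leaves_in.
apply/zy/hz => //.
  by apply: inner_prefix hT yz zT _; rewrite eq_sym; apply/eqP.
by have := all0 y yl; rewrite yl /= subr_eq0 eq_sym.
Qed.

Lemma cut_none T (Q : pred (seq B)) : (forall y, y \in inner T -> ~~ Q y) ->
  cut_below T Q = T.
Proof.
move=> h; apply/fsetP => z; apply/in_cut/idP => [[]//|zT]; split=> // y yi.
by rewrite (negbTE (h y yi)).
Qed.

Lemma eq_cut T (Q Q' : pred (seq B)) : {in inner T, Q =1 Q'} ->
  cut_below T Q = cut_below T Q'.
Proof.
move=> h; apply/fsetP => z; apply/in_cut/in_cut => -[zT hz]; split=> // y yi.
  by rewrite -h //; exact: hz.
by rewrite h //; exact: hz.
Qed.

Lemma cut_proper T (Q : pred (seq B)) y : is_tree T -> y \in inner T -> Q y ->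
  (#|` cut_below T Q| < #|` T|)%N.
Proof.
move=> hT yi Qy; apply/fproper_ltn_card; rewrite fproperE cut_sub /=.
have [_ [c cT]] := innerP _ hT yi; apply/negP => /fsubsetP/(_ _ cT).
move=> /in_cut[_ /(_ y yi Qy)]; rewrite prefix_rcons => /(_ isT).
by move=> /(congr1 size)/eqP; rewrite size_rcons -addn1 -[X in _ == X]addn0 eqn_add2l.
Qed.

Lemma smallest_optimal_selfP l T : is_tree T ->
  (sopt l T T <-> forall y, y \in inner T -> b_excess T y < l * a_excess T y).
Proof.
move=> hT; split; last first.
  move=> h; have := smallest_optimal_cut hT (fun y yi => ltW (h y yi)).
  by rewrite cut_none // => y /h; rewrite lt_neqAle => /andP[].
(* The competitor cut at [y] alone differs from [T] in cost by exactly the gap at [y]. Optimality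
   makes this gap nonnegative, and minimality makes it nonzero. *)
move=> [_ h] y yi; have hC := is_tree_cut_below (pred1 y) hT.
have sC : subtree (cut_below T (pred1 y)) T by split=> //; exact: cut_sub.
have yC : y \in cut_below T (pred1 y).
  by apply/in_cut; split=> [|w _ /eqP -> //]; exact: inner_in.
have ylC : y \in leaves (cut_below T (pred1 y)).
  apply/leavesP; split=> // c; apply/negP => /in_cut[_ /(_ y yi (eqxx _))].
  rewrite prefix_rcons => /(_ isT)/(congr1 size)/eqP.
  by rewrite size_rcons -addn1 -[X in _ == X]addn0 eqn_add2l.
have eJ : tree_J P Y S l (cut_below T (pred1 y)) =
    tree_J P Y S l T + (l * a_excess T y - b_excess T y).
  rewrite (tree_J_sub _ hT sC) (bigD1_seq y) ?fset_uniq //=; congr (_ + _).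
  rewrite big_seq_cond big1 ?addr0 // => z /andP[/(leaves_cut hT)[|[_ /eqP ->]]].
    by move=> /(excess_leaf hT)[-> ->]; rewrite mulr0 subr0.
  by rewrite eqxx.
have [lJ eq] := h _ sC; rewrite lt_neqAle; apply/andP; split; last first.
  by move: lJ; rewrite eJ lerDl subr_ge0.
apply/negP => /eqP e; have := @cut_proper T (pred1 y) y hT yi (eqxx _).
rewrite ltnNge fsubset_leq_card // eq //.
by rewrite eJ e subrr addr0.
Qed.

End Pruning.

(** * Pruning at extended real levels *)

Lemma bigmaxe_attained (R : realType) (K : eqType) (s : seq K) (F : K -> \bar R) :
  s != [::] -> exists2 y, y \in s & F y = \big[maxe/-oo%E]_(z <- s) F z.
Proof.
elim: s => [//|y s IH _]; rewrite big_cons.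
have [->|/IH[z zs <-]] := eqVneq s [::].
  by exists y; [exact: mem_head|rewrite big_nil maxeNy].
rewrite maxEle; case: ifP => _; [exists z|exists y] => //.
  by rewrite inE zs orbT.
exact: mem_head.
Qed.

Section PruningSequence.
Context {R : realType} {d : measure_display} {Omega : measurableType d}.
Context {B : finType}.
Variables (P : probability Omega R) (Y : nat -> Omega -> B) (S : Omega -> nat).
Local Notation a := (cost_a P Y S).
Local Notation b := (cost_b P Y S).
Hypothesis a_decr : forall y, increment a y <= 0.
Hypothesis b_incr : forall y, 0 <= increment b y.
Implicit Types (T U : tree B) (y z s : seq B) (r : R) (l : \bar R).
Local Notation sopt := (smallest_optimal P Y S).
Local Notation prune := (prune P Y S).
Local Notation aexc := (a_excess P Y S).
Local Notation bexc := (b_excess P Y S).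

(** What [prune] selects at an extended level; at [+oo] one tree must be optimal at all large finite
    levels. *)
Definition optimal_at l T U : Prop :=
  match l with
  | r%:E%E => sopt r T U
  | +oo%E => exists M : R, forall r, M < r -> sopt r T U
  | -oo%E => False
  end.

(** For [+oo]: smallest optimal subtrees grow with the level inside a finite tree, so past a level
    where the largest cardinality is reached they are constant. *)
Lemma optimal_at_exists l T : is_tree T -> (0 <= l)%E -> exists U, optimal_at l T U.
Proof.
move=> hT; case: l => [r _| _|//]; first exact: smallest_optimal_exists.
have [|U [_ [r0 h0] minU]] := exists_minimizer
  (s := fpowerset T) (Q := fun U => exists r, sopt r T U)
  (fun U => - (#|` U|%:R : R)).
  have [U hU] := smallest_optimal_exists P Y S 0 hT.
  by exists U; [rewrite fpowersetE; case: hU => -[]|exists 0].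
exists U, r0 => r r0r; have [V hV] := smallest_optimal_exists P Y S r hT.
have sUV : (U `<=` V)%fset by exact: smallest_optimal_mono h0 hV (ltW r0r).
have VT : V \in fpowerset T by rewrite fpowersetE; case: hV => -[].
have := minU V VT (ex_intro _ r hV); rewrite lerN2 ler_nat => c.
suff -> : U = V by [].
by apply/eqP; rewrite eqEfcard sUV.
Qed.

Lemma optimal_at_uniq l T U1 U2 : optimal_at l T U1 -> optimal_at l T U2 -> U1 = U2.
Proof.
case: l => [r||//] /=; first exact: smallest_optimal_uniq.
move=> [M1 h1] [M2 h2]; pose r := Num.max M1 M2 + 1.
apply: (@smallest_optimal_uniq _ _ _ _ P Y S r T).
  by apply: h1; rewrite /r ltr_pwDr // le_max lexx.
by apply: h2; rewrite /r ltr_pwDr // le_max lexx orbT.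
Qed.

Lemma prune_smallest_optimal l T : is_tree T -> (0 <= l)%E -> optimal_at l T (prune T l).
Proof.
move=> hT l0; have [U hU] := optimal_at_exists hT l0.
case: l l0 hU => [r||//] l0 /= hU.
  by case: xgetP => [V _ //|] /(_ U).
have hU' : \forall r \near +oo, sopt r T U.
  by case: hU => M hM; exists M; split => //; exact: num_real.
by case: xgetP => [V _ [M [_ hM]]|/(_ U) //]; exists M.
Qed.

Lemma optimal_at_prune l T U : is_tree T -> (0 <= l)%E -> optimal_at l T U -> prune T l = U.
Proof. by move=> hT l0; apply: optimal_at_uniq; exact: prune_smallest_optimal. Qed.

Lemma optimal_at_sub l T U : optimal_at l T U -> subtree U T.
Proof. by case: l => [r||//] /= [M] // /(_ (M + 1)) []//; rewrite ltrDl. Qed.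

Lemma optimal_at_restrict l T T' U : optimal_at l T U -> subtree T' T ->
  (U `<=` T')%fset -> optimal_at l T' U.
Proof.
case: l => [r||//] /=; first exact: smallest_optimal_restrict.
move=> [M h] sT' sU; exists M => r /h hr; exact: smallest_optimal_restrict hr sT' sU.
Qed.

Lemma optimal_at_mono l l' T U U' : optimal_at l T U ->
  optimal_at l' T U' -> (l <= l')%E -> (U `<=` U')%fset.
Proof.
case: l => [r||//]; case: l' => [r'||//] //=.
- by rewrite lee_fin; exact: smallest_optimal_mono.
- move=> h [M h'] _; pose r1 := Num.max r M + 1.
  have Mr1 : M < r1 by rewrite /r1 ltr_pwDr // le_max lexx orbT.
  apply: smallest_optimal_mono h (h' _ Mr1) _ => //.
  by rewrite ltW // /r1 ltr_pwDr // le_max lexx.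
- move=> h h' _; suff -> : U = U' by [].
  exact: (@optimal_at_uniq +oo%E T).
Qed.

(* Fails for the complete tree iff the first pruning level is +oo. *)
Definition reduces_a T : Prop := forall y, y \in inner T -> 0 < aexc T y.

(** The value [-oo] at a tree reduced to its root lies below the level 0, so such a tree is left
    unchanged by every level. *)
Definition gmax T : \bar R := \big[maxe/-oo%E]_(y <- inner T) g P Y S y T.

Lemma g_reduces_a T y : 0 < aexc T y -> g P Y S y T = (bexc T y / aexc T y)%:E.
Proof.
move=> a0; rewrite /g -/(aexc T y) -/(bexc T y).
by rewrite inver gt_eqF.
Qed.

Lemma gmax_lt T l : (-oo < l)%E ->
  ((gmax T < l)%E <-> forall y, y \in inner T -> (g P Y S y T < l)%E).
Proof.
move=> l0; rewrite /gmax; split=> [h y yi|h].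
  by apply: le_lt_trans h; exact: (@le_bigmax_seq _ _ _ _ -oo%E y xpredT).
rewrite big_seq; elim/big_ind: _ => // u v hu hv; by rewrite gt_max hu hv.
Qed.

Lemma gmax_attained T : inner T != fset0 ->
  exists2 y, y \in inner T & g P Y S y T = gmax T.
Proof. by rewrite -cardfs_eq0 size_eq0; exact: bigmaxe_attained. Qed.

Lemma gmax_root T : inner T = fset0 -> gmax T = -oo%E.
Proof. by move=> i0; rewrite /gmax i0 big_nil. Qed.

(** The bound on [g] does not imply [reduces_a T]: where both excesses vanish, [g] is 0, yet the
    strict inequality of [smallest_optimal_selfP] fails at every level. *)
Lemma prune_selfP T l : is_tree T -> (0 <= l)%E ->
  (prune T l = T <-> reduces_a T /\ (gmax T < l)%E).
Proof.
move=> hT l0; have l00 : (-oo < l)%E by apply: lt_le_trans l0.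
rewrite gmax_lt //; split.
- move=> e; have := prune_smallest_optimal hT l0; rewrite e.
  have main r : 0 <= r -> sopt r T T -> reduces_a T /\
      forall y, y \in inner T -> (g P Y S y T < r%:E)%E.
    move=> r0 /(smallest_optimal_selfP P Y S r hT) h.
    have lT : reduces_a T.
      move=> y yi; have b0 := b_excess_ge0 b_incr hT (inner_in yi).
      have : 0 < r * aexc T y by exact: le_lt_trans (h y yi).
      by rewrite pmulr_rgt0 // lt_neqAle r0 andbT; apply/eqP => r00;
         have := h y yi; rewrite -r00 mul0r ltNge b0.
    split=> // y yi; rewrite g_reduces_a ?lT // lte_fin ltr_pdivrMr ?lT //; exact: h.
  case: l l0 l00 e => [r||//] l0 _ _ /=.
    by apply: main; rewrite -lee_fin.
  move=> [M hM]; pose r1 := Num.max M 0 + 1.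
  have Mr1 : M < r1 by rewrite /r1 ltr_pwDr // le_max lexx.
  have r10 : 0 <= r1 by rewrite /r1 addr_ge0 // le_max lexx orbT.
  have [lT h] := main r1 r10 (hM _ Mr1).
  by split=> // y yi; rewrite (lt_trans (h y yi)) // ltry.
- move=> [lT h]; apply: optimal_at_prune => //.
  have main r : (forall y, y \in inner T -> (g P Y S y T < r%:E)%E) -> sopt r T T.
    move=> hr; apply/(smallest_optimal_selfP P Y S r hT) => y yi.
    by move: (hr y yi); rewrite g_reduces_a ?lT // lte_fin ltr_pdivrMr ?lT.
  case: l l0 l00 h => [r||//] l0 _ h /=; first exact: main.
  (* The maximal [g] is attained, hence finite under [reduces_a], and serves as the threshold that
     [optimal_at] requires at [+oo]. *)
  have [i0|[y0 y0i e0]] : inner T = fset0 \/ exists2 y, y \in inner T & g P Y S y T = gmax T.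
  - have [->|/gmax_attained] := eqVneq (inner T) fset0; [by left|by right].
  - by exists 0 => r _; apply: main => y; rewrite i0 inE.
  - exists (fine (g P Y S y0 T)) => r hr; apply: main; apply/gmax_lt; first exact: ltNyr.
    by rewrite -e0 g_reduces_a ?lT // lte_fin; move: hr; rewrite g_reduces_a ?lT.
Qed.

(** By [prune_selfP], the levels up to [l] that leave a tree unchanged form an interval open at
    [gmax], and [next_level] is its infimum. *)
Lemma ereal_inf_oc (h l : \bar R) : (0 <= h)%E -> (h < l)%E ->
  ereal_inf [set x | (0 <= x <= l)%E /\ (h < x)%E] = h.
Proof.
move=> h0 hl; set E := [set x | _]; apply/eqP; rewrite eq_le; apply/andP; split; last first.
  by apply: le_ereal_inf_tmp => x [_ /ltW].
rewrite leNgt; apply/negP => hi.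
have il : (ereal_inf E <= l)%E.
  by apply: ereal_inf_lbound; split=> //; rewrite lexx andbT (le_trans h0) // ltW.
have [x [hx xi]] : exists x, (h < x)%E /\ (x < ereal_inf E)%E.
  move: (ereal_inf E) hi {il} => [i||].
  - case: h h0 hl @E => [h||//] h0 hl E.
      rewrite lte_fin => hi; exists ((h + i) / 2)%:E; rewrite !lte_fin.
      by split; move: hi; lra.
    by rewrite ltNge leey.
  - case: h h0 hl @E => [h||//] h0 hl E _; last by move: hl; rewrite ltNge leey.
    by exists (h + 1)%:E; rewrite lte_fin ltry; split=> //; lra.
  - by rewrite ltNge leNye.
have : (ereal_inf E <= x)%E.
  apply: ereal_inf_lbound; split=> //.
  by rewrite (le_trans h0 (ltW hx)) (le_trans (ltW xi)).
by rewrite leNgt xi.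
Qed.

Lemma gmax_ge0 T : is_tree T -> inner T != fset0 -> (0 <= gmax T)%E.
Proof.
move=> hT /gmax_attained[y yi <-]; rewrite /g -/(aexc T y) -/(bexc T y).
have yT := inner_in yi; have a0 := a_excess_ge0 a_decr hT yT.
by rewrite mule_ge0 ?inve_ge0 ?lee_fin ?b_excess_ge0.
Qed.

Definition next_level T l : \bar R :=
  ereal_inf [set x | (0 <= x <= l)%E /\ prune T x = T].

Lemma next_level_gmax T l : is_tree T -> reduces_a T -> inner T != fset0 ->
  (gmax T < l)%E -> next_level T l = gmax T.
Proof.
move=> hT lT i0 gl; have g0 := gmax_ge0 hT i0.
rewrite -[RHS](ereal_inf_oc g0 gl); congr ereal_inf.
apply/seteqP; split=> x [/andP[x0 xl]] h; split; rewrite ?x0 //.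
  by have [_ ] := (prune_selfP hT x0).1 h.
exact/(prune_selfP hT x0).
Qed.

Lemma next_level_root T l : is_tree T -> inner T = fset0 -> (0 <= l)%E ->
  next_level T l = 0%E.
Proof.
move=> hT i0 l0; apply/eqP; rewrite eq_le; apply/andP; split; last first.
  by apply: le_ereal_inf_tmp => x [/andP[]].
apply: ereal_inf_lbound; split; first by rewrite lexx.
apply/prune_selfP => //; split; first by move=> y; rewrite i0 inE.
by apply/gmax_lt => // y; rewrite i0 inE.
Qed.

Lemma next_level_infty T l : is_tree T -> ~ reduces_a T -> next_level T l = +oo%E.
Proof.
move=> hT nl; rewrite /next_level (_ : [set x | _] = set0) ?ereal_inf0 //.
by apply/seteqP; split=> x //= [/andP[x0 _]] /(prune_selfP hT x0)[].
Qed.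

Lemma next_level_ge0 T l : (0 <= next_level T l)%E.
Proof. by apply: le_ereal_inf_tmp => x [/andP[]]. Qed.

Lemma prune_gmax T : is_tree T -> reduces_a T -> inner T != fset0 ->
  gmax T \is a fin_num ->
  prune T (gmax T) = cut_below T (fun y => g P Y S y T == gmax T).
Proof.
move=> hT lT i0 gf; have g0 := gmax_ge0 hT i0.
apply: optimal_at_prune => //; rewrite -(fineK gf) /=.
have gle y : y \in inner T -> (g P Y S y T <= gmax T)%E.
  move=> yi; exact: (@le_bigmax_seq _ _ _ _ -oo%E y xpredT).
rewrite -(@eq_cut _ T (fun y => bexc T y == fine (gmax T) * aexc T y)).
  apply: smallest_optimal_cut => // y yi; move: (gle y yi).
  by rewrite -[in X in X -> _](fineK gf) g_reduces_a ?lT // lee_fin ler_pdivrMr ?lT.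
move=> y yi; rewrite g_reduces_a ?lT // eqe.
have a0 := lt0r_neq0 (lT y yi).
by apply/eqP/eqP => [->|<-]; rewrite ?mulfK ?divfK.
Qed.

End PruningSequence.

(** * The costs of a node *)

Section FiniteMeasure.
Context {R : realType} {d : measure_display} {Omega : measurableType d}.
Variable P : probability Omega R.
Implicit Types E F : set Omega.

Lemma prE E : measurable E -> (pr P E)%:E = P E.
Proof. by move=> mE; rewrite /pr fineK // fin_num_measure. Qed.

Lemma pr_ge0 E : 0 <= pr P E.
Proof. exact: fine_ge0. Qed.

Lemma pr_set0 : pr P set0 = 0.
Proof. by rewrite /pr measure0. Qed.

Lemma pr_setT : pr P setT = 1.
Proof. by rewrite /pr probability_setT. Qed.

Lemma prU E F : measurable E -> measurable F -> E `&` F = set0 ->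
  pr P (E `|` F) = pr P E + pr P F.
Proof.
move=> mE mF EF; apply: EFin_inj; rewrite EFinD !prE //; last exact: measurableU.
by rewrite measureU.
Qed.

Lemma pr_le E F : measurable E -> measurable F -> E `<=` F -> pr P E <= pr P F.
Proof. by move=> mE mF EF; rewrite -lee_fin !prE // le_measure // inE. Qed.

Lemma pr_eq0_sub E F : measurable E -> measurable F -> E `<=` F -> pr P F = 0 ->
  pr P E = 0.
Proof. by move=> mE mF EF F0; apply/le_anti; rewrite pr_ge0 -F0 pr_le. Qed.

Lemma pr_partition (I : finType) (f : Omega -> I) E : measurable E ->
  (forall c, measurable [set w | f w = c]) ->
  pr P E = \sum_(c : I) pr P (E `&` [set w | f w = c]).
Proof.
move=> mE mf.
have step (s : seq I) : uniq s ->
    measurable (E `&` [set w | f w \in s]) /\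
    pr P (E `&` [set w | f w \in s]) = \sum_(c <- s) pr P (E `&` [set w | f w = c]).
  elim: s => [_|c s IH] /=.
    rewrite big_nil (_ : E `&` _ = set0) ?pr_set0; first by split.
    by apply/seteqP; split=> w [] //=; rewrite in_nil.
  move=> /andP[cs /IH[ms es]]; rewrite big_cons -es.
  have -> : E `&` [set w | f w \in c :: s] =
      (E `&` [set w | f w = c]) `|` (E `&` [set w | f w \in s]).
    apply/seteqP; split=> w /=.
      by rewrite inE => -[Ew /orP[/eqP ->|]]; [left|right].
    by move=> [[Ew ->]|[Ew fs]]; split=> //; rewrite inE ?eqxx // fs orbT.
  have mc : measurable (E `&` [set w | f w = c]) by exact: measurableI.
  split; first exact: measurableU.
  rewrite prU //; apply/seteqP; split=> w //= [[_ e] [_]].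
  by rewrite e (negbTE cs).
have [_ e] := step (enum I) (enum_uniq _).
rewrite big_enum in e; rewrite -e; congr (pr P _).
by apply/seteqP; split=> w => [Ew|[]//]; split=> //=; rewrite mem_enum.
Qed.

(** The integrands are truncated differences, which [count_below] writes as sums of indicators.
    Expectations thus become finite sums of probabilities. *)
Lemma integral_count (D : set Omega) (A : nat -> set Omega) (K : nat)
    (h : Omega -> nat) : measurable D -> (forall j, measurable (A j)) ->
  (forall w, D w -> (h w)%:R = \sum_(j < K) \1_(A j) w :> R) ->
  fine (\int[P]_(w in D) ((h w)%:R)%:E) = \sum_(j < K) pr P (A j `&` D).
Proof.
move=> mD mA hh.
rewrite (eq_integral (fun w => \sum_(j < K) (\1_(A j) w)%:E)%E); last first.
  by move=> w; rewrite inE => /hh ->; rewrite sumEFin.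
rewrite ge0_integral_sum //; last first.
  by move=> j; apply/measurable_EFinP; exact: measurable_indic.
rewrite (eq_bigr (fun j : 'I_K => (pr P (A j `&` D))%:E)); last first.
  by move=> j _; rewrite integral_indic // prE //; exact: measurableI.
by rewrite sumEFin.
Qed.

Lemma count_below (n m K : nat) : (n <= K)%N ->
  (n - m)%N = (\sum_(j < K) ((m <= j) && (j < n)))%N.
Proof.
elim: K n => [|K IH] n; first by rewrite leqn0 => /eqP ->; rewrite big_ord0.
rewrite big_ord_recr /= leq_eqVlt => /orP[/eqP ->|nK]; last first.
  by rewrite ltnS in nK; rewrite -IH // [(K < n)%N]ltnNge nK andbF addn0.
rewrite ltnS leqnn andbT.
rewrite (eq_bigr (fun j : 'I_K => ((m <= j) && (j < K))%N : nat)); last first.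
  by move=> j _; rewrite ltn_ord ltnS (ltnW (ltn_ord j)).
rewrite -IH //; case: leqP => h; first by rewrite addn1 subSn.
rewrite addn0; have /eqP -> : (K.+1 - m == 0)%N by rewrite subn_eq0.
by apply/esym/eqP; rewrite subn_eq0 ltnW.
Qed.

Lemma measurable_nat_preimage (T : Omega -> nat) (Q : nat -> Prop) :
  (forall n, measurable [set w | T w = n]) -> measurable [set w | Q (T w)].
Proof.
move=> mT; rewrite (_ : [set w | _] = \bigcup_(n in Q) [set w | T w = n]).
  by apply: bigcup_measurable => n _; exact: mT.
by apply/seteqP; split=> [w Qw|w [n Qn /= ->]//]; exists (T w).
Qed.

Lemma measurable_late (S T : Omega -> nat) j :
  (forall n, measurable [set w | S w = n]) ->
  (forall n, measurable [set w | T w = n]) ->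
  measurable [set w | (S w <= j < T w)%N].
Proof.
move=> mS mT; rewrite (_ : [set w | _] = [set w | (S w <= j)%N] `&` [set w | (j < T w)%N]).
  apply: measurableI; first exact: (measurable_nat_preimage (fun n => (n <= j)%N)).
  exact: (measurable_nat_preimage (fun n => (j < n)%N)).
by apply/seteqP; split=> w /= => [/andP[]|[-> ->]].
Qed.

Lemma measurable_early (S T : Omega -> nat) :
  (forall n, measurable [set w | S w = n]) ->
  (forall n, measurable [set w | T w = n]) ->
  measurable [set w | (T w < S w)%N].
Proof.
move=> mS mT.
rewrite (_ : [set w | _] = \bigcup_n ([set w | T w = n] `&` [set w | (n < S w)%N])).
  apply: bigcup_measurable => n _; apply: measurableI => //.
  exact: (measurable_nat_preimage (fun k => (n < k)%N)).
by apply/seteqP; split=> [w ?|w [n _ /= [-> //]]]; exists (T w).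
Qed.

Lemma delayE (T S : Omega -> nat) K : (forall n, measurable [set w | T w = n]) ->
  (forall n, measurable [set w | S w = n]) -> (forall w, (T w <= K)%N) ->
  delay P T S = \sum_(j < K) pr P [set w | (S w <= j < T w)%N].
Proof.
move=> mT mS TK; rewrite /delay unlock.
rewrite (@integral_count setT (fun j => [set w | (S w <= j < T w)%N]) K
    (fun w => (T w - S w)%N)) //.
- by apply: eq_bigr => j _; rewrite setIT.
- by move=> j; exact: measurable_late.
- move=> w _; rewrite (@count_below _ _ K) // natr_sum; apply: eq_bigr => j _.
  by rewrite indicE mem_setE.
Qed.

End FiniteMeasure.

Lemma past_rcons {d} {Omega : measurableType d} {A : Type} (Z : nat -> Omega -> A) z c :
  past_is Z (rcons z c) = past_is Z z `&` [set w | Z (size z) w = c].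
Proof.
apply/seteqP; split=> w; rewrite /past_is /past /= size_rcons mkseqS.
  by move=> /rcons_inj[-> ->].
by move=> [-> ->].
Qed.

Lemma past_size {Omega A : Type} (Z : nat -> Omega -> A) n w :
  size (past Z n w) = n.
Proof. exact: size_mkseq. Qed.

Lemma past_take {Omega A : Type} (Z : nat -> Omega -> A) m n w : (m <= n)%N ->
  take m (past Z n w) = past Z m w.
Proof.
move=> mn; rewrite /past /mkseq -map_take take_iota.
by congr map; congr iota; exact/minn_idPl.
Qed.

Lemma past_is_prefix {d} {Omega : measurableType d} {B : eqType}
    (Z : nat -> Omega -> B) x y :
  prefix x y -> past_is Z y `<=` past_is Z x.
Proof.
move=> xy w; rewrite /past_is /= => e.
rewrite -(past_take Z w (size_prefix xy)) e; apply/eqP.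
by rewrite -prefixE.
Qed.

Section Costs.
Context {R : realType} {d : measure_display} {Omega : measurableType d}.
Context {B : finType}.
Variables (P : probability Omega R) (Y : nat -> Omega -> B) (S : Omega -> nat).
Hypothesis Y_meas : forall i y, measurable [set w | Y i w = y].
Hypothesis S_meas : forall n, measurable [set w | S w = n].
Local Notation a := (cost_a P Y S).
Local Notation b := (cost_b P Y S).
Implicit Types (y z : seq B).

Lemma measurable_past y : measurable (past_is Y y).
Proof.
elim/last_ind: y => [|y c IH]; last by rewrite past_rcons; exact: measurableI.
by rewrite (_ : past_is _ _ = setT) //; apply/seteqP.
Qed.

Lemma measurable_S (Q : nat -> Prop) : measurable [set w | Q (S w)].
Proof. exact: measurable_nat_preimage. Qed.

(** The division cancels if the past has positive probability; otherwise both sides vanish. *)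
Lemma cost_aE y : a y = pr P (past_is Y y `&` [set w | (size y < S w)%N]).
Proof.
have mF := measurable_past y; have mS := measurable_S (fun n => size y < n)%N.
rewrite /cost_a /cond_pr setIC; have [F0|F0] := eqVneq (pr P (past_is Y y)) 0.
  rewrite F0 mul0r; apply/esym/(@pr_eq0_sub _ _ _ _ _ (past_is Y y)) => //.
  exact: measurableI.
by rewrite mulrC divfK.
Qed.

Lemma cost_bE y :
  b y = \sum_(j < size y) pr P (past_is Y y `&` [set w | (S w <= j)%N]).
Proof.
have mF := measurable_past y.
have mS j : measurable [set w | (S w <= j)%N] by exact: (measurable_S (fun n => n <= j)%N).
have e : Rintegral P (past_is Y y) (fun w => ((size y - S w)%N)%:R) =
    \sum_(j < size y) pr P (past_is Y y `&` [set w | (S w <= j)%N]).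
  rewrite /Rintegral (@integral_count _ _ _ _ _ (fun j => [set w | (S w <= j)%N])
     (size y) (fun w => (size y - S w)%N)) //.
    by apply: eq_bigr => j _; rewrite setIC.
  move=> w _; rewrite (@count_below _ _ (size y)) // natr_sum; apply: eq_bigr => j _.
  by rewrite indicE mem_setE ltn_ord andbT.
rewrite /cost_b /cond_exp e; have [F0|F0] := eqVneq (pr P (past_is Y y)) 0.
  rewrite F0 mul0r; apply/esym; apply: big1 => j _.
  by apply: (@pr_eq0_sub _ _ _ _ _ (past_is Y y)) => //; exact: measurableI.
by rewrite mulrC divfK.
Qed.

Lemma pr_past_children y E : measurable E ->
  \sum_(c : B) pr P (past_is Y (rcons y c) `&` E) = pr P (past_is Y y `&` E).
Proof.
move=> mE; rewrite [RHS](pr_partition _ _ (Y_meas (size y))); last first.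
  by apply: measurableI => //; exact: measurable_past.
by apply: eq_bigr => c _; rewrite past_rcons setIAC.
Qed.

Lemma increment_a y :
  increment a y = - pr P (past_is Y y `&` [set w | S w = (size y).+1]).
Proof.
have mS n := measurable_S (fun k => n < k)%N.
rewrite /increment cost_aE; under eq_bigr do rewrite cost_aE size_rcons.
rewrite pr_past_children //; apply/eqP; rewrite subr_eq addrC -subr_eq opprK eq_sym.
rewrite -prU //; try by apply: measurableI => //; exact: measurable_past.
  apply/eqP; congr (pr P _); rewrite -setIUr; congr (_ `&` _).
  apply/seteqP; split=> w /=; first by rewrite leq_eqVlt => /orP[/eqP|]; [right|left].
  by move=> [/ltnW//|->].
by apply/seteqP; split=> w //= [[_ h] [_ e]]; move: h; rewrite e ltnn.
Qed.

Lemma increment_b y :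
  increment b y = pr P (past_is Y y `&` [set w | (S w <= size y)%N]).
Proof.
have mS n := measurable_S (fun k => k <= n)%N.
rewrite /increment; under eq_bigr do rewrite cost_bE size_rcons.
rewrite exchange_big /= cost_bE big_ord_recr /=.
rewrite pr_past_children // addrAC; apply/eqP; rewrite -subr_eq0 addrK subr_eq0.
by apply/eqP/eq_bigr => j _; rewrite pr_past_children.
Qed.

Lemma increment_a_le0 y : increment a y <= 0.
Proof. by rewrite increment_a oppr_le0 pr_ge0. Qed.

Lemma increment_b_ge0 y : 0 <= increment b y.
Proof. by rewrite increment_b pr_ge0. Qed.

Lemma cost_a_ge0 y : 0 <= a y.
Proof. by rewrite cost_aE pr_ge0. Qed.

Lemma cost_b_ge0 y : 0 <= b y.
Proof. by rewrite cost_bE sumr_ge0 // => j _; rewrite pr_ge0. Qed.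

Lemma cost_b_nil : b [::] = 0.
Proof. by rewrite cost_bE big_ord0. Qed.

End Costs.

(** * Stopping at the leaves of a tree *)

Section TreeStop.
Context {R : realType} {d : measure_display} {Omega : measurableType d}.
Context {B : finType}.
Variables (P : probability Omega R) (Y : nat -> Omega -> B) (S : Omega -> nat).
Hypothesis Y_meas : forall i y, measurable [set w | Y i w = y].
Hypothesis S_meas : forall n, measurable [set w | S w = n].
Implicit Types (T U : tree B) (y z : seq B) (w : Omega).

Lemma past_prefix m n w : (m <= n)%N -> prefix (past Y m w) (past Y n w).
Proof. by move=> mn; rewrite -(past_take Y w mn) prefix_take. Qed.

Lemma tree_stop_leaf T w : is_tree T -> past Y (tree_stop Y T w) w \in leaves T.
Proof.
move=> hT; set H := \max_(y <- T) size y.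
(* A past longer than every node is not inner, so it has a leaf as prefix, and the search bounded by
   the height of [T] succeeds. *)
have out : past Y H.+1 w \notin inner T.
  apply/negP => /inner_in yT; have : (H.+1 <= H)%N.
    by rewrite -{1}(past_size Y H.+1 w); exact: (@leq_bigmax_seq _ _ xpredT size).
  by rewrite ltnn.
have [y yl yp] := leaf_prefix_ex hT out.
have ey : past Y (size y) w = y.
  move: (size_prefix yp); rewrite past_size => h.
  by rewrite -(past_take Y w h); apply/eqP; rewrite -prefixE.
have hs : has (fun n => past Y n w \in leaves T) (iota 0 H.+1).
  apply/hasP; exists (size y); last by rewrite ey.
  rewrite mem_iota ltnS /=; apply: (@leq_bigmax_seq _ _ xpredT size) => //.
  exact: leaves_in.
have := nth_find 0 hs; rewrite nth_iota ?add0n //.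
by rewrite -[X in (_ < X)%N](size_iota 0) -has_find.
Qed.

Lemma tree_stopP T n w : is_tree T ->
  (tree_stop Y T w = n) <-> (past Y n w \in leaves T).
Proof.
move=> hT; split=> [<-|nl]; first exact: tree_stop_leaf.
have sl := tree_stop_leaf w hT.
rewrite -(past_size Y n w) -(past_size Y (tree_stop Y T w) w); congr size.
apply: (leaf_prefix_uniq (s := past Y (maxn n (tree_stop Y T w)) w) hT) => //.
  by apply: past_prefix; exact: leq_maxr.
by apply: past_prefix; exact: leq_maxl.
Qed.

Lemma tree_stop_past T z w : is_tree T -> past_is Y z w ->
  (tree_stop Y T w = size z) <-> (z \in leaves T).
Proof. by move=> hT Fz; rewrite (tree_stopP _ _ hT) Fz. Qed.

Lemma tree_stop_bound T K w : is_tree T -> (T `<=` complete_tree B K)%fset ->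
  (tree_stop Y T w <= K)%N.
Proof.
move=> hT /fsubsetP sT; rewrite -[X in (X <= _)%N](past_size Y _ w).
by rewrite -mem_complete_tree; apply/sT/leaves_in/tree_stop_leaf.
Qed.

Lemma measurable_tree_stop T n : is_tree T ->
  measurable [set w | tree_stop Y T w = n].
Proof.
move=> hT; rewrite (_ : [set w | _] =
    \big[setU/set0]_(z <- leaves T | size z == n) past_is Y z).
  by apply: bigsetU_measurable => z _; exact: measurable_past.
rewrite -bigcup_seq_cond; apply/seteqP; split=> w.
  move=> /= /(tree_stopP _ _ hT) nl; exists (past Y n w) => /=.
    by rewrite nl past_size eqxx.
  by rewrite /past_is /= past_size.
move=> [z /= /andP[zl /eqP <-]] Fz; exact/tree_stop_past.
Qed.

Lemma pr_leaves T (E : set Omega) : is_tree T -> measurable E ->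
  pr P E = \sum_(z <- leaves T) pr P (past_is Y z `&` E).
Proof.
move=> hT mE; rewrite big_seq_fsetE /=.
(* The leaf that is reached, packed with its membership proof, is a map into a finite type, as
   [pr_partition] requires. *)
pose f w : leaves T := [` tree_stop_leaf w hT]%fset.
have ef c : [set w | f w = c] = past_is Y (val c).
  apply/seteqP; split=> w /=; first by move=> <-; rewrite /past_is /= past_size.
  move=> Fc; apply/val_inj => /=.
  by rewrite ((tree_stop_past hT Fc).2 (valP c)).
rewrite (@pr_partition _ _ _ _ _ f) // => [|c]; last by rewrite ef; exact: measurable_past.
by apply: eq_bigr => c _; rewrite ef setIC.
Qed.

Lemma early_tree_stop T : is_tree T -> early P (tree_stop Y T) S = tree_a P Y S T.
Proof.
move=> hT; have mT n := measurable_tree_stop n hT.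
rewrite /early (pr_leaves hT); last exact: measurable_early.
rewrite /tree_a big_seq [RHS]big_seq; apply: eq_bigr => z zl.
rewrite cost_aE //; congr (pr P _); apply/seteqP; split=> w [Fz] /=.
  by rewrite ((tree_stop_past hT Fz).2 zl).
by rewrite ((tree_stop_past hT Fz).2 zl).
Qed.

Lemma delay_tree_stop T K : is_tree T -> (T `<=` complete_tree B K)%fset ->
  delay P (tree_stop Y T) S = tree_b P Y S T.
Proof.
move=> hT sT; have mT n := measurable_tree_stop n hT.
rewrite (@delayE _ _ _ P _ S K) //; last by move=> w; exact: tree_stop_bound.
under eq_bigr => j _.
  rewrite (pr_leaves hT); last exact: measurable_late.
  over.
rewrite exchange_big /= /tree_b big_seq [RHS]big_seq; apply: eq_bigr => z zl.
have zK : (size z <= K)%N.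
  by rewrite -mem_complete_tree; apply/(fsubsetP sT)/leaves_in.
rewrite cost_bE // (big_ord_widen K
  (fun j => pr P (past_is Y z `&` [set w | (S w <= j)%N]))) //.
rewrite [RHS]big_mkcond /=; apply: eq_bigr => j _.
case: ifPn => jz.
  congr (pr P _); apply/seteqP; split=> w [Fz] /=.
    by rewrite ((tree_stop_past hT Fz).2 zl) => /andP[].
  by rewrite ((tree_stop_past hT Fz).2 zl) jz andbT.
rewrite (_ : _ `&` _ = set0) ?pr_set0 //; apply/seteqP; split=> w //= [Fz].
by rewrite ((tree_stop_past hT Fz).2 zl) (negbTE jz) andbF.
Qed.

(** A probability space is nonempty, so [Y] takes some value. Over an empty alphabet a complete tree
    would be its root, whatever its depth. *)
Lemma card_alphabet_gt0 : (0 < #|B|)%N.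
Proof.
have [w _] : [set: Omega] !=set0.
  apply/set0P/eqP => e0; have := probability_setT P.
  by rewrite e0 measure0 => -[/eqP]; rewrite eq_sym oner_eq0.
by apply/card_gt0P; exists (Y 0 w).
Qed.

Lemma leaves_complete k y : y \in leaves (complete_tree B k) -> size y = k.
Proof.
move=> yl; have := leaves_in yl; rewrite mem_complete_tree => yk.
apply/eqP; rewrite eqn_leq yk leqNgt -inner_complete; last exact: card_alphabet_gt0.
by rewrite inner_leaf ?yl // leaves_in.
Qed.

Lemma complete_sub k k' : (k <= k')%N ->
  (complete_tree B k `<=` complete_tree B k')%fset.
Proof.
move=> kk'; apply/fsubsetP => y; rewrite !mem_complete_tree => /leq_trans; exact.
Qed.

Section BoundedS.
Variable kappa : nat.
Hypothesis S_le : {ae P, forall w, (S w <= kappa)%N}.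

Lemma pr_S_gt : pr P [set w | (kappa < S w)%N] = 0.
Proof.
have mS := measurable_S S_meas (fun n => kappa < n)%N.
suff -> : pr P [set w | (kappa < S w)%N] = fine 0%E by [].
congr fine; apply/negligibleP => //; apply: negligibleS S_le => w /=.
by move=> h /= h'; move: h; rewrite ltnNge h'.
Qed.

Lemma cost_a_kappa y : (kappa <= size y)%N -> cost_a P Y S y = 0.
Proof.
move=> ky; rewrite cost_aE //.
apply: (@pr_eq0_sub _ _ _ _ _ [set w | (kappa < S w)%N]); last exact: pr_S_gt.
- apply: measurableI; first exact: measurable_past.
  exact: (measurable_S S_meas (fun n => size y < n)%N).
- exact: (measurable_S S_meas (fun n => kappa < n)%N).
- by move=> w [_ /=]; exact: leq_ltn_trans.
Qed.

Lemma tree_a_complete : tree_a P Y S (complete_tree B kappa) = 0.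
Proof.
rewrite /tree_a big_seq big1 // => y yl; apply: cost_a_kappa.
by rewrite (leaves_complete yl).
Qed.

(* The complete tree whose depth is the least value of S: it stops no later than
   S, and at S with positive probability. *)
Lemma exists_free_tree : exists U, [/\ is_tree U, (U `<=` complete_tree B kappa)%fset,
  tree_b P Y S U = 0 & tree_a P Y S U < 1].
Proof.
have mS k := measurable_S S_meas (fun n => n <= k)%N.
have mS' k := measurable_S S_meas (fun n => k < n)%N.
have compl k : pr P [set w | (S w <= k)%N] + pr P [set w | (k < S w)%N] = 1.
  rewrite -prU //; last by apply/seteqP; split=> w //= []; rewrite ltnNge => ->.
  rewrite -(pr_setT P); congr (pr P _); apply/seteqP; split=> w // _ /=.
  by case: (leqP (S w) k) => h; [left|right].
have ex : exists k, 0 < pr P [set w | (S w <= k)%N].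
  by exists kappa; move: (compl kappa); rewrite pr_S_gt addr0 => ->.
have [s s0 smin] := ex_minnP ex.
have sk : (s <= kappa)%N.
  by apply: smin; move: (compl kappa); rewrite pr_S_gt addr0 => ->.
exists (complete_tree B s); split.
- exact: is_tree_complete.
- exact: complete_sub.
- rewrite /tree_b big_seq big1 // => y /leaves_complete ys.
  rewrite cost_bE // big1 // => j _.
  apply: (@pr_eq0_sub _ _ _ _ _ [set w | (S w <= j)%N]) => //.
    by apply: measurableI => //; exact: measurable_past.
  apply/eqP; rewrite eq_le pr_ge0 andbT leNgt; apply/negP => /smin.
  by rewrite leqNgt -ys ltn_ord.
- have -> : tree_a P Y S (complete_tree B s) = pr P [set w | (s < S w)%N].
    rewrite (pr_leaves (is_tree_complete s)) // /tree_a big_seq [RHS]big_seq.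
    by apply: eq_bigr => y /leaves_complete ys; rewrite cost_aE // ys.
  by rewrite -(compl s) ltrDr.
Qed.

End BoundedS.

End TreeStop.

(** * Backward induction along the complete tree *)

Section BackwardInduction.
Context {R : realType} {B : finType}.
Variable f : seq B -> R.
Implicit Types (T : tree B) (y z : seq B).

Lemma leaf_sum_children T z : is_tree T -> z \in inner T ->
  leaf_sum f (subtree_at T z) = \sum_(c : B) leaf_sum f (subtree_at T (rcons z c)).
Proof.
move=> hT zi; rewrite leaf_sum_subtree_at.
under [RHS]eq_bigr do rewrite leaf_sum_subtree_at big_mkcond.
rewrite exchange_big big_mkcond /=; apply: eq_big_seq => u ul.
have [/prefixP[[|e t] eu]|zu] := boolP (prefix z u).
- by move: ul; rewrite eu cats0; have := inner_leaf (inner_in zi); rewrite zi => /esym/negP.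
- have pc c : prefix (rcons z c) u = (c == e).
    rewrite eu -cats1 -[e :: t]cat1s prefix_catr // eqxx /= prefix0s andbT.
    by [].
  by rewrite (bigD1 e) //= pc eqxx big1 ?addr0 // => c /negbTE; rewrite pc => ->.
- rewrite big1 // => c _; case: ifPn => // /(prefix_trans (prefix_rcons z c)).
  by rewrite (negbTE zu).
Qed.

(** The value function of optimal stopping with [k] letters left. The cost [f] is meant to include
    the probability of the node, so continuing is an unweighted sum. *)
Fixpoint backward_min (k : nat) z : R :=
  if k is k'.+1 then Num.min (f z) (\sum_(c : B) backward_min k' (rcons z c)) else f z.

Lemma backward_min_le k z : backward_min k z <= f z.
Proof. by case: k => //= k; rewrite ge_min lexx. Qed.

Lemma take_le_rcons i y c : (i <= size y)%N -> take i (rcons y c) = take i y.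
Proof. by move=> iy; rewrite -cats1 takel_cat. Qed.

Lemma backward_min_tree K : (0 < #|B|)%N -> exists T,
  [/\ is_tree T, (T `<=` complete_tree B K)%fset & leaf_sum f T = backward_min K [::]].
Proof.
(* [T] consists of the nodes reached by continuing only where this is strictly cheaper. At depth [K]
   nothing is left to gain and [cont] is false. *)
move=> /card_gt0P[c0 _]; pose cont y := backward_min (K - size y) y < f y.
pose T : tree B := [fset z in complete_tree B K |
  [forall i : 'I_(size z), cont (take i z)]]%fset.
have TP z : reflect ((size z <= K)%N /\ forall i, (i < size z)%N -> cont (take i z))
    (z \in T).
  rewrite !inE /= mem_complete_tree; apply: (iffP andP) => -[zK h]; split=> //.
    by move=> i iz; exact: (forallP h (Ordinal iz)).
  by apply/forallP => i; exact: h.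
have hT : is_tree T.
  split; first by apply/TP.
  move=> y c /TP[]; rewrite size_rcons => yK h; split.
    apply/TP; split; first exact: ltnW.
    by move=> i iy; have := h i (ltnW iy); rewrite take_le_rcons // ltnW.
  move=> c'; apply/TP; rewrite size_rcons; split=> // i iy.
  by have := h i iy; rewrite !take_le_rcons.
exists T; split=> //; first by apply/fsubsetP => z /TP[]; rewrite mem_complete_tree.
rewrite -[in LHS](subtree_at_nil T).
have: (size ([::] : seq B) + K = K)%N by [].
have: [::] \in T by exact: tree_nil.
(* The claim is generalized from the root to any node [z] of [T] with [k] letters left. *)
elim: {1 3}K ([::]) => [|k IH] z zT zk.
  rewrite leaf_sum_leaf //; apply/leavesP; split=> // c; apply/negP => /TP[].
  by rewrite size_rcons -zk addn0 ltnn.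
have zK : (size z < K)%N by rewrite -zk addnS ltnS leq_addr.
have ek : (K - size z = k.+1)%N by rewrite -zk addKn.
have cT c : (rcons z c \in T) = cont z.
  apply/TP/idP; rewrite size_rcons.
    by move=> [_ /(_ _ (ltnSn _))]; rewrite -cats1 take_size_cat.
  move=> cz.
  split=> // i; rewrite ltnS leq_eqVlt => /orP[/eqP ->|iz].
    by rewrite -cats1 take_size_cat.
  by rewrite take_le_rcons ?(ltnW iz) //; exact: (TP _ zT).2.
have [cz|ncz] := boolP (cont z); last first.
  rewrite leaf_sum_leaf //; last by apply/leavesP; split=> // c; rewrite cT.
  by apply/le_anti; rewrite backward_min_le andbT leNgt -ek.
have zi : z \in inner T by apply/innerP => //; split=> //; exists c0; rewrite cT.
rewrite leaf_sum_children // (eq_bigr (fun c => backward_min k (rcons z c))).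
  by move: cz; rewrite /cont ek /= minElt; case: ifP; rewrite ?ltxx.
by move=> c _; apply: IH; rewrite ?cT // size_rcons addSnnS.
Qed.

End BackwardInduction.

(** * Lagrangian lower bound on randomized stopping times *)

Section LowerBound.
Context {R : realType} {d d' : measure_display}.
Context {Omega : measurableType d} {Omega' : measurableType d'}.
Context {A B : finType}.
Variables (P : probability Omega R) (P' : probability Omega' R).
Variables (X : nat -> Omega -> A) (Y : nat -> Omega -> B) (S : Omega -> nat).
Variables (p : Omega' -> Omega) (T : Omega' -> nat) (kappa : nat).
Hypothesis Y_meas : forall i y, measurable [set w | Y i w = y].
Hypothesis S_meas : forall n, measurable [set w | S w = n].
Local Notation Y' := (fun i => Y i \o p).
Local Notation S' := (S \o p).
Local Notation V := (future_events (fun i => X i \o p) 0 `|`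
             [set E | exists s, E = [set w | S' w = s]]).
Hypothesis p_meas : measurable_fun setT p.
Hypothesis p_pres : forall E, measurable E -> P' (p @^-1` E) = P E.
Hypothesis T_stop : stopping_time P' Y' V T.
Hypothesis T_le : forall w, (T w <= kappa)%N.
Implicit Types (y z : seq B).

Let F z := past_is Y' z.

Lemma past_is_comp z : F z = p @^-1` past_is Y z.
Proof. by []. Qed.

Let F_rcons z c : F (rcons z c) = F z `&` [set w | Y' (size z) w = c].
Proof. exact: past_rcons. Qed.

Lemma measurable_pullback E : measurable E -> measurable (p @^-1` E).
Proof. by move=> mE; rewrite -[_ @^-1` _]setTI; exact: p_meas. Qed.

Lemma pr_pullback E : measurable E -> pr P' (p @^-1` E) = pr P E.
Proof. by move=> mE; rewrite /pr p_pres. Qed.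

Let Y'_meas i (c : B) : measurable [set w | Y' i w = c].
Proof. exact: (measurable_pullback (Y_meas i c)). Qed.

Let S'_meas n : measurable [set w | S' w = n].
Proof. exact: (measurable_pullback (S_meas n)). Qed.

Let T_meas n : measurable [set w | T w = n].
Proof. exact: T_stop.1. Qed.

Let F_meas z : measurable (F z).
Proof. exact: measurable_past. Qed.

(** The past [z] is the past [y] intersected with a future event, so the conditional probability of
    stopping at time [size y] is the same given [z] as given [y]. *)
Lemma stop_indep_past y z : prefix y z ->
  pr P' ([set w | T w = size y] `&` F z) * pr P' (F y) =
  pr P' ([set w | T w = size y] `&` F y) * pr P' (F z).
Proof.
move=> /prefixP[t ->].
have [E [sE eE]] : exists E, <<s future_events Y' (size y) `|` V >> E /\
    E `&` F y = F (y ++ t).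
  elim/last_ind: t => [|t c [E [sE eE]]].
    exists setT; split; last by rewrite setTI cats0.
    exact: (@measurableT _ (g_sigma_algebraType (future_events Y' (size y) `|` V))).
  exists (E `&` [set w | Y' (size (y ++ t)) w = c]); split; last first.
    by rewrite -rcons_cat F_rcons -eE setIAC.
  apply: (@measurableI _ (g_sigma_algebraType (future_events Y' (size y) `|` V))) => //.
  apply: sub_gen_smallest; left; exists (size (y ++ t)), c.
  by rewrite size_cat leq_addr.
have := T_stop.2 y E sE; cbv zeta; rewrite -setIA.
by rewrite -[past_is _ y]/(F y) eE.
Qed.

Lemma stop_indep_S z (Q : nat -> Prop) :
  pr P' ([set w | T w = size z] `&` [set w | Q (S' w)] `&` F z) * pr P' (F z) =
  pr P' ([set w | T w = size z] `&` F z) * pr P' ([set w | Q (S' w)] `&` F z).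
Proof.
apply: T_stop.2.
apply: (@measurable_nat_preimage _
  (g_sigma_algebraType (future_events Y' (size z) `|` V)) S' Q) => n.
by apply: sub_gen_smallest; right; right; exists n.
Qed.

Definition stop_at z := pr P' ([set w | T w = size z] `&` F z).
Definition stop_from n z := pr P' ([set w | (n <= T w)%N] `&` F z).

Let mT (Q : nat -> Prop) : measurable [set w | Q (T w)].
Proof. exact: measurable_nat_preimage. Qed.

Lemma stop_from_split z n : stop_from n z =
  pr P' ([set w | T w = n] `&` F z) + stop_from n.+1 z.
Proof.
rewrite /stop_from -prU.
- congr (pr P' _); rewrite -setIUl; congr (_ `&` _); apply/seteqP; split=> w /=.
    by rewrite leq_eqVlt => /orP[/eqP|]; [left|right].
  by move=> [->//|/ltnW].
- exact: measurableI.
- exact: measurableI (mT (fun k => n < k)%N) _.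
- by apply/seteqP; split=> w //= [[-> _] []]; rewrite ltnn.
Qed.

(** The conditional probability of continuing beyond [y] does not depend on the next letter. The
    events T = 0, ..., T = [size y] are removed one by one, each through [stop_indep_past] at the
    prefix of [y] of that length. *)
Lemma stop_from_child y c :
  stop_from (size y).+1 (rcons y c) * pr P' (F y) =
  stop_from (size y).+1 y * pr P' (F (rcons y c)).
Proof.
set z := rcons y c.
have yz : prefix y z by exact: prefix_rcons.
suff main n : (n <= (size y).+1)%N ->
    stop_from n z * pr P' (F y) = stop_from n y * pr P' (F z) by exact: main.
elim: n => [_|n IH ny].
  have e : [set w | (0 <= T w)%N] = setT by apply/seteqP; split.
  by rewrite /stop_from e !setTI; exact: mulrC.
have := IH (ltnW ny); rewrite (stop_from_split z) (stop_from_split y) !mulrDl.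
suff -> : pr P' ([set w | T w = n] `&` F z) * pr P' (F y) =
          pr P' ([set w | T w = n] `&` F y) * pr P' (F z) by move/addrI.
rewrite ltnS in ny; pose x := take n y.
have sx : size x = n.
  rewrite size_take; move: ny; rewrite leq_eqVlt => /orP[/eqP ->|->//].
  by rewrite ltnn.
have xy : prefix x y by exact: prefix_take.
have xz : prefix x z by exact: prefix_trans xy yz.
(* [stop_indep_past] carries the factor [pr P' (F x)], which cancels only if nonzero; a null prefix
   makes its extensions null. *)
have [F0|F0] := eqVneq (pr P' (F x)) 0.
  have Fy0 : pr P' (F y) = 0 by apply: (pr_eq0_sub _ _ (past_is_prefix xy) F0).
  have Fz0 : pr P' (F z) = 0 by apply: (pr_eq0_sub _ _ (past_is_prefix xz) F0).
  by rewrite Fy0 Fz0 !mulr0.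
apply: (mulIf F0).
have := stop_indep_past xy; have := stop_indep_past xz; rewrite sx => ez ey.
by rewrite mulrAC ez [RHS]mulrAC ey mulrAC.
Qed.

Variable l : R.
Hypothesis l_ge0 : 0 <= l.
Local Notation J := (cost_J P Y S l).

(* The part of E (T - S)^+ + l P(T < S) contributed by an event. *)
Definition cost_on (E : set Omega') : R :=
  \sum_(j < kappa) pr P' (E `&` [set w | (S' w <= j < T w)%N]) +
  l * pr P' (E `&` [set w | (T w < S' w)%N]).

Let mlate j : measurable [set w | (S' w <= j < T w)%N].
Proof. exact: measurable_late. Qed.

Let mearly : measurable [set w | (T w < S' w)%N].
Proof. exact: measurable_early. Qed.

Lemma cost_on_ge0 E : 0 <= cost_on E.
Proof.
by rewrite addr_ge0 ?mulr_ge0 ?pr_ge0 // sumr_ge0 // => j _; exact: pr_ge0.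
Qed.

Lemma cost_onU E E' : measurable E -> measurable E' -> E `&` E' = set0 ->
  cost_on (E `|` E') = cost_on E + cost_on E'.
Proof.
move=> mE mE' EE'.
have h D : measurable D ->
    pr P' ((E `|` E') `&` D) = pr P' (E `&` D) + pr P' (E' `&` D).
  move=> mD; rewrite setIUl prU //; try exact: measurableI.
  by rewrite setIACA EE' set0I.
rewrite /cost_on h // mulrDr [RHS]addrACA -big_split; congr (_ + _).
by apply: eq_bigr => j _; exact: h.
Qed.

Lemma cost_on_partition z E : measurable E ->
  cost_on (F z `&` E) = \sum_(c : B) cost_on (F (rcons z c) `&` E).
Proof.
move=> mE; rewrite /cost_on big_split /= -mulr_sumr exchange_big /=.
congr (_ + l * _); last first.
  rewrite -setIA -(@pr_past_children _ _ _ _ P' Y' Y'_meas) //; last exact: measurableI.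
  by apply: eq_bigr => c _; rewrite setIA.
apply: eq_bigr => j _.
rewrite -setIA -(@pr_past_children _ _ _ _ P' Y' Y'_meas) //; last exact: measurableI.
by apply: eq_bigr => c _; rewrite setIA.
Qed.

(** Given the past, the decision to stop ignores [S], so the probabilities that make up [J z]
    factor. On T = [size z], lateness at [j] reads S <= j < [size z]. *)
Lemma cost_on_stop z : (size z <= kappa)%N ->
  cost_on (F z `&` [set w | T w = size z]) * pr P' (F z) = stop_at z * J z.
Proof.
move=> zk; rewrite /cost_J cost_aE // cost_bE // /cost_on mulrDl mulrDr.
congr (_ + _).
  rewrite mulr_suml mulr_sumr.
  rewrite (big_ord_widen kappa
    (fun j => stop_at z * pr P (past_is Y z `&` [set w | (S w <= j)%N]))) //.
  rewrite [RHS]big_mkcond /=; apply: eq_bigr => j _; case: ifPn => jz.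
    rewrite -pr_pullback; last first.
      apply: measurableI; first exact: measurable_past.
      exact: (measurable_S S_meas (fun k => k <= j)%N).
    rewrite preimage_setI -past_is_comp [X in _ = _ * pr _ X]setIC.
    rewrite -(stop_indep_S z (fun k => k <= j)%N); congr (pr P' _ * _).
    apply/seteqP; split=> w /=; first by move=> [[Fz ->] /andP[->]].
    by move=> [[-> Sj] Fz]; rewrite Sj jz.
  rewrite (_ : _ `&` _ = set0) ?pr_set0 ?mul0r //; apply/seteqP; split=> w //=.
  by move=> [[_ ->]]; rewrite (negbTE jz) andbF.
rewrite mulrCA -mulrA; congr (_ * _); rewrite -pr_pullback; last first.
  apply: measurableI; first exact: measurable_past.
  exact: (measurable_S S_meas (fun k => size z < k)%N).
rewrite preimage_setI -past_is_comp [X in _ = _ * pr _ X]setIC.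
rewrite -(stop_indep_S z (fun k => size z < k)%N); congr (pr P' _ * _).
apply/seteqP; split=> w /=; first by move=> [[Fz ->] ->].
by move=> [[-> Sj] Fz].
Qed.

Lemma cost_J_null z : pr P' (F z) = 0 -> J z = 0.
Proof.
rewrite past_is_comp pr_pullback; last exact: measurable_past.
by move=> F0; rewrite /cost_J /cost_a /cost_b F0 !mul0r mulr0 addr0.
Qed.

(** Stopping at [z] costs [J z] and continuing costs the sum over the children, each at least the
    minimum of the two. By [stop_from_child] all children share one weight; the factor [pr P' (F z)]
    replaces conditioning on the past. *)
Lemma backward_min_lower k z : (size z + k = kappa)%N ->
  stop_from (size z) z * backward_min J k z <=
  cost_on (F z `&` [set w | (size z <= T w)%N]) * pr P' (F z).
Proof.
elim: k z => [|k IH] z zk.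
  have eT : [set w | (size z <= T w)%N] = [set w | T w = size z].
    apply/seteqP; split=> w /= => [h|->//]; apply/eqP; rewrite eqn_leq h andbT.
    by rewrite -[X in (_ <= X)%N]addn0 zk.
  by rewrite /stop_from eT cost_on_stop -?zk ?leq_addr.
have zk' : (size z <= kappa)%N by rewrite -zk leq_addr.
have -> : F z `&` [set w | (size z <= T w)%N] =
    (F z `&` [set w | T w = size z]) `|` (F z `&` [set w | (size z < T w)%N]).
  rewrite -setIUr; congr (_ `&` _); apply/seteqP; split=> w /=.
    by rewrite leq_eqVlt => /orP[/eqP|]; [left|right].
  by move=> [->//|/ltnW].
rewrite cost_onU; last 3 first.
- exact: measurableI.
- exact: measurableI (mT (fun k => size z < k)%N).
- by apply/seteqP; split=> w //= [[_ ->] []]; rewrite ltnn.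
rewrite mulrDl cost_on_stop // stop_from_split mulrDl lerD //.
  by rewrite ler_wpM2l ?pr_ge0 // backward_min_le.
rewrite cost_on_partition; last exact: (mT (fun k => size z < k)%N).
apply: (@le_trans _ _ (stop_from (size z).+1 z * \sum_c backward_min J k (rcons z c))).
  by rewrite ler_wpM2l ?pr_ge0 //= ge_min lexx orbT.
rewrite mulr_sumr mulr_suml; apply: ler_sum => c _; set zc := rcons z c.
(* The induction hypothesis is void at a null child. There [J] is 0, hence [backward_min] is at most
   0, while costs are nonnegative. *)
have [F0|F0] := eqVneq (pr P' (F zc)) 0.
  apply: (@le_trans _ _ 0); last by rewrite mulr_ge0 ?cost_on_ge0 ?pr_ge0.
  by rewrite mulr_ge0_le0 ?pr_ge0 // -(cost_J_null F0) backward_min_le.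
have Fp : 0 < pr P' (F zc) by rewrite lt_neqAle eq_sym F0 pr_ge0.
have szc : size zc = (size z).+1 by rewrite size_rcons.
have := IH zc; rewrite szc addSnnS => /(_ zk) ih.
rewrite -(ler_pM2r Fp) mulrAC -stop_from_child mulrAC [X in _ <= X]mulrAC.
by rewrite ler_wpM2r // pr_ge0.
Qed.

Lemma lagrangian_lower : backward_min J kappa [::] <= delay P' T S' + l * early P' T S'.
Proof.
have := @backward_min_lower kappa [::] erefl.
have Fnil : F [::] = setT by apply/seteqP; split.
have eT : [set w | (0 <= T w)%N] = setT by apply/seteqP; split.
rewrite /stop_from /= eT Fnil setTI pr_setT mul1r mulr1.
rewrite /cost_on (delayE P' (K := kappa)) // /early; congr (_ <= _ + _ * _).
  by apply: eq_bigr => j _; rewrite !setTI.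
by rewrite !setTI.
Qed.

End LowerBound.

Section FeasibleLowerBound.
Context {R : realType} {d : measure_display} {Omega : measurableType d}.
Context {A B : finType}.
Variables (P : probability Omega R).
Variables (X : nat -> Omega -> A) (Y : nat -> Omega -> B).
Variables (S : Omega -> nat) (kappa : nat).
Hypothesis Y_meas : forall i y, measurable [set w | Y i w = y].
Hypothesis S_meas : forall n, measurable [set w | S w = n].

(** Weak duality: the bound of [lagrangian_lower] is itself the cost of a subtree, and [l >= 0] lets
    [alpha] replace P(T < S). *)
Lemma feasible_ge (T : tree B) (l alpha v : R) : 0 <= l ->
  (forall U, subtree U (complete_tree B kappa) -> tree_J P Y S l T <= tree_J P Y S l U) ->
  feasible P X Y S kappa alpha v -> tree_J P Y S l T <= v + l * alpha.
Proof.
move=> l0 Tmin [d1] [W1] [P1] [p] [T1] [] [mp pp] T_stop T_le ea <-.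
have [U [hU sU eU]] := backward_min_tree (cost_J P Y S l) kappa (card_alphabet_gt0 P Y).
apply: le_trans (Tmin U (conj hU sU)) _.
rewrite [tree_J _ _ _ _ _]eU.
apply: le_trans (lagrangian_lower Y_meas S_meas mp pp T_stop T_le l0) _.
by rewrite lerD2l ler_wpM2l.
Qed.

Lemma feasible_ge0 alpha v : feasible P X Y S kappa alpha v -> 0 <= v.
Proof.
case=> d1 [W1] [P1] [p] [T1] [] [mp pp] T_stop T_le ea <-.
rewrite (delayE P1 (K := kappa)) //.
- by rewrite sumr_ge0 // => j _; exact: pr_ge0.
- by move=> n; exact: T_stop.1.
- by move=> n; exact: (measurable_pullback mp (S_meas n)).
Qed.

End FeasibleLowerBound.

(** * Randomizing between two trees *)

Section Mixture.
Context {R : realType} {d : measure_display} {Omega : measurableType d}.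
Context {A B : finType}.
Variables (P : probability Omega R).
Variables (X : nat -> Omega -> A) (Y : nat -> Omega -> B).
Variables (S : Omega -> nat) (kappa : nat).
Hypothesis X_meas : forall i x, measurable [set w | X i w = x].
Hypothesis Y_meas : forall i y, measurable [set w | Y i w = y].
Hypothesis S_meas : forall n, measurable [set w | S w = n].
Variable t : R.
Hypothesis t01 : 0 <= t <= 1.

(** The extension of the space requested by [feasible]: an independent coin chooses which of two
    trees to follow. *)
Definition with_coin : probability (Omega * bool)%type R :=
  (P \x (bernoulli_prob t : probability bool R))%E.

Lemma measurable_coin (E1 E2 : set Omega) : measurable E1 -> measurable E2 ->
  measurable [set x : Omega * bool | if x.2 then E1 x.1 else E2 x.1].
Proof.
move=> m1 m2.
rewrite (_ : [set x | _] = (E1 `*` [set true]) `|` (E2 `*` [set false])).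
  by apply: measurableU; apply: measurableX.
apply/seteqP; split=> -[w []] /=; [by left|by right|by move=> [[]|[]]|by move=> [[]|[]]].
Qed.

Lemma pr_coin (E1 E2 : set Omega) : measurable E1 -> measurable E2 ->
  pr with_coin [set x | if x.2 then E1 x.1 else E2 x.1] =
  t * pr P E1 + (1 - t) * pr P E2.
Proof.
move=> m1 m2.
rewrite (_ : [set x | _] = (E1 `*` [set true]) `|` (E2 `*` [set false])); last first.
  apply/seteqP; split=> -[w []] /=; [by left|by right|by move=> [[]|[]]|by move=> [[]|[]]].
rewrite prU; first last.
- by apply/seteqP; split=> -[w c] //= [[_ ->] []].
- exact: measurableX.
- exact: measurableX.
have rect (E : set Omega) (C : set bool) : measurable E ->
    with_coin (E `*` C) = (P E * bernoulli_prob t C)%E.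
  by move=> mE; exact: product_measure1E.
rewrite /pr !rect //.
have e1 : bernoulli_prob t [set true] = t%:E.
  by rewrite /bernoulli_prob t01 fsbig_set1.
have e2 : bernoulli_prob t [set false] = (1 - t)%:E.
  by rewrite /bernoulli_prob t01 fsbig_set1.
by rewrite e1 e2 -(prE P m1) -(prE P m2) -!EFinM /= mulrC [in X in _ + X]mulrC.
Qed.

Lemma pr_fst E : measurable E -> pr with_coin (fst @^-1` E) = pr P E.
Proof.
move=> mE; rewrite (_ : fst @^-1` E = [set x | if x.2 then E x.1 else E x.1]).
  by rewrite pr_coin // -mulrDl addrC subrK mul1r.
by apply/seteqP; split=> -[w []].
Qed.

Variables (U1 U2 : tree B).
Hypotheses (hU1 : is_tree U1) (hU2 : is_tree U2).
Hypotheses (sU1 : (U1 `<=` complete_tree B kappa)%fset).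
Hypotheses (sU2 : (U2 `<=` complete_tree B kappa)%fset).

Definition mixed_stop (x : Omega * bool) : nat :=
  if x.2 then tree_stop Y U1 x.1 else tree_stop Y U2 x.1.

Lemma measurable_mixed_stop n : measurable [set x | mixed_stop x = n].
Proof.
rewrite (_ : [set x | _] = [set x | if x.2 then [set w | tree_stop Y U1 w = n] x.1
                                   else [set w | tree_stop Y U2 w = n] x.1]).
  by apply: measurable_coin; exact: measurable_tree_stop.
by apply/seteqP; split=> -[w []].
Qed.

Lemma early_mixed : early with_coin mixed_stop (S \o fst) =
  t * tree_a P Y S U1 + (1 - t) * tree_a P Y S U2.
Proof.
rewrite -!early_tree_stop // /early -pr_coin; try
  by apply: measurable_early => // n; exact: measurable_tree_stop.
by congr pr; apply/seteqP; split=> -[w []].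
Qed.

Lemma mixed_stop_le x : (mixed_stop x <= kappa)%N.
Proof. by case: x => w [] /=; exact: tree_stop_bound. Qed.

Lemma measurable_S_fst n : measurable [set x : Omega * bool | (S \o fst) x = n].
Proof. exact: (measurable_pullback (@measurable_fst _ _ Omega bool) (S_meas n)). Qed.

Lemma delay_mixed : delay with_coin mixed_stop (S \o fst) =
  t * tree_b P Y S U1 + (1 - t) * tree_b P Y S U2.
Proof.
have m1 n := @measurable_tree_stop _ _ _ Y Y_meas U1 n hU1.
have m2 n := @measurable_tree_stop _ _ _ Y Y_meas U2 n hU2.
rewrite -(delay_tree_stop P Y_meas S_meas hU1 sU1).
rewrite -(delay_tree_stop P Y_meas S_meas hU2 sU2).
rewrite (delayE _ (K := kappa) measurable_mixed_stop measurable_S_fst mixed_stop_le).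
rewrite !(delayE P (K := kappa)) //; try by move=> w; exact: tree_stop_bound.
rewrite !mulr_sumr -big_split; apply: eq_bigr => j _ /=.
rewrite -pr_coin; try exact: measurable_late.
by congr pr; apply/seteqP; split=> -[w []].
Qed.

Lemma pr_stop_past (U : tree B) z (E : set Omega) : is_tree U ->
  pr P ([set w | tree_stop Y U w = size z] `&` E `&` past_is Y z) =
  (z \in leaves U)%:R * pr P (E `&` past_is Y z).
Proof.
move=> hU; case: (boolP (z \in leaves U)) => [zl|zl]; rewrite /= ?mul1r ?mul0r.
  congr (pr P _); apply/seteqP; split=> w; first by move=> [[]].
  by move=> [Ew Fz]; split=> //; split=> //; exact/tree_stop_past.
rewrite (_ : _ `&` _ = set0) ?pr_set0 //; apply/seteqP; split=> w //= [[sw _] Fz].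
by move: zl => /negP; apply; exact/(tree_stop_past hU Fz).
Qed.

(** All generators are pulled back along [fst], hence so is the generated sigma-algebra: none of its
    events depends on the coin. *)
Lemma future_measurable_fst n E :
  <<s future_events (fun i => Y i \o fst) n `|`
      (future_events (fun i => X i \o fst) 0 `|`
       [set E | exists s, E = [set x : Omega * bool | (S \o fst) x = s]]) >> E ->
  exists2 E0, measurable E0 & E = fst @^-1` E0.
Proof.
move=> sE.
have [E0 mE0] : preimage_set_system setT (@fst Omega bool) measurable E.
  apply: smallest_sub sE.
    by apply: sigma_algebra_preimage; exact: sigma_algebra_measurable.
  have pre D : measurable D ->
      preimage_set_system setT (@fst Omega bool) measurable (fst @^-1` D).
    by move=> mD; exists D; rewrite ?setTI.
  move=> D [[i [y [_ ->]]]|[[i [x [_ ->]]]|[s ->]]].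
  - exact: (pre _ (Y_meas i y)).
  - exact: (pre _ (X_meas i x)).
  - exact: (pre _ (S_meas s)).
by rewrite setTI => <-; exists E0.
Qed.

(** On the past [z], stopping at time [size z] multiplies the probability of any event not seeing
    the coin by a weight that depends on [z] alone; taking [setT] for the event identifies this
    weight. *)
Lemma mixed_stopping_time : stopping_time with_coin (fun i => Y i \o fst)
  (future_events (fun i => X i \o fst) 0 `|`
   [set E | exists s, E = [set x : Omega * bool | (S \o fst) x = s]]) mixed_stop.
Proof.
split; first exact: measurable_mixed_stop.
move=> z E /future_measurable_fst[E0 mE0 ->] /=.
have mF := measurable_past Y_meas z.
have m1 n := @measurable_tree_stop _ _ _ Y Y_meas U1 n hU1.
have m2 n := @measurable_tree_stop _ _ _ Y Y_meas U2 n hU2.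
have h D : measurable D ->
    pr with_coin ([set x | mixed_stop x = size z] `&` (fst @^-1` D) `&`
                  (fst @^-1` past_is Y z)) =
    (t * (z \in leaves U1)%:R + (1 - t) * (z \in leaves U2)%:R) *
      pr P (D `&` past_is Y z).
  move=> mD; rewrite mulrDl -!mulrA -!pr_stop_past // -pr_coin;
    try by apply: measurableI => //; exact: measurableI.
  by congr pr; apply/seteqP; split=> -[w []].
have hT := h setT measurableT; rewrite preimage_setT setIT setTI in hT.
rewrite [past_is _ _](_ : _ = fst @^-1` past_is Y z) // h // hT.
rewrite -preimage_setI !pr_fst //; last exact: measurableI.
by rewrite -!mulrA; congr (_ * _); exact: mulrC.
Qed.

Lemma feasible_mixed alpha :
  t * tree_a P Y S U1 + (1 - t) * tree_a P Y S U2 <= alpha ->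
  feasible P X Y S kappa alpha (t * tree_b P Y S U1 + (1 - t) * tree_b P Y S U2).
Proof.
move=> le_alpha.
exists _, (Omega * bool)%type, with_coin, fst, mixed_stop; split.
- split; first exact: measurable_fst.
  move=> E mE; rewrite -(prE P mE) -(pr_fst mE) prE //.
  exact: (measurable_pullback (@measurable_fst _ _ Omega bool) mE).
- exact: mixed_stopping_time.
- exact: mixed_stop_le.
- by rewrite early_mixed.
- exact: delay_mixed.
Qed.

End Mixture.

(** * The pruning sequence *)

Section Sequence.
Context {R : realType} {d : measure_display} {Omega : measurableType d}.
Context {B : finType}.
Variables (P : probability Omega R) (Y : nat -> Omega -> B) (S : Omega -> nat).
Variable kappa : nat.
Hypothesis Y_meas : forall i y, measurable [set w | Y i w = y].
Hypothesis S_meas : forall n, measurable [set w | S w = n].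
Hypothesis S_le : {ae P, forall w, (S w <= kappa)%N}.
Implicit Types (T U : tree B) (y z : seq B) (r : R) (l : \bar R) (m : nat).
Local Notation lam := (lambda P Y S kappa).
Local Notation tr := (ptree P Y S kappa).
Local Notation prune := (prune P Y S).
Local Notation gmax := (gmax P Y S).
Local Notation reduces_a := (reduces_a P Y S).
Local Notation g := (g P Y S).
Local Notation K0 := (complete_tree B kappa).
Local Notation ta := (tree_a P Y S).
Local Notation tb := (tree_b P Y S).

Let a_decr := increment_a_le0 P Y_meas S_meas.
Let b_incr := increment_b_ge0 P Y_meas S_meas.

Lemma lambdaS m : lam m.+1 = next_level P Y S (tr m) (lam m).
Proof. by rewrite /lambda /ptree /=; case: (pruning P Y S kappa m). Qed.

Lemma ptreeS m : tr m.+1 = prune (tr m) (lam m.+1).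
Proof. by rewrite lambdaS /lambda /ptree /=; case: (pruning P Y S kappa m). Qed.

Lemma lambda_ge0 m : (0 <= lam m)%E.
Proof. by case: m => [|m]; [exact: leey|rewrite lambdaS; exact: next_level_ge0]. Qed.

Lemma is_tree_ptree m : is_tree (tr m).
Proof.
elim: m => [|m IH]; first exact: is_tree_complete.
by rewrite ptreeS; have [] := optimal_at_sub (prune_smallest_optimal a_decr IH (lambda_ge0 m.+1)).
Qed.

Lemma ptree_smallest_optimal m : optimal_at P Y S (lam m.+1) (tr m) (tr m.+1).
Proof.
by rewrite ptreeS; apply: prune_smallest_optimal => //;
  [exact: is_tree_ptree|exact: lambda_ge0].
Qed.

Lemma ptree_subS m : (tr m.+1 `<=` tr m)%fset.
Proof. by have [] := optimal_at_sub (ptree_smallest_optimal m). Qed.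

Lemma ptree_sub m : (tr m `<=` K0)%fset.
Proof.
by elim: m => [|m]; [exact: fsubset_refl|apply: fsubset_trans; exact: ptree_subS].
Qed.

Lemma ptree_sub0 m : subtree (tr m) K0.
Proof. by split; [exact: is_tree_ptree|exact: ptree_sub]. Qed.

(* By [prune_selfP], this is [prune (tr m) (lam m) = tr m]. *)
Definition self_pruned m : Prop := reduces_a (tr m) /\ (gmax (tr m) < lam m)%E.

(** An optimum among the subtrees of [tr m] is one among its own subtrees. The resulting inequality
    between [gmax] and the level is strict, which is what makes consecutive slopes distinct. *)
Lemma self_prunedS m : self_pruned m.+1.
Proof.
have hT := is_tree_ptree m.+1; have l0 := lambda_ge0 m.+1.
apply/(prune_selfP a_decr b_incr hT l0)/optimal_at_prune => //.
apply: optimal_at_restrict (ptree_smallest_optimal m) _ (fsubset_refl _).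
by split=> //; exact: ptree_subS.
Qed.

Lemma self_pruned0 : reduces_a K0 -> self_pruned 0.
Proof.
move=> lT; split=> //; apply/gmax_lt; first by [].

by move=> y yi; rewrite g_reduces_a ?lT // ltry.
Qed.

Lemma gmax_fin m : self_pruned m -> inner (tr m) != fset0 -> gmax (tr m) \is a fin_num.
Proof.
move=> [_ gl] i0.
have g0 := gmax_ge0 a_decr b_incr (is_tree_ptree m) i0.
rewrite ge0_fin_numE //.
by apply: lt_le_trans gl _; exact: leey.
Qed.

Lemma lambda_gmax m : self_pruned m -> inner (tr m) != fset0 -> lam m.+1 = gmax (tr m).
Proof.
move=> [lT gl] i0; rewrite lambdaS; apply: next_level_gmax => //.
exact: is_tree_ptree.
Qed.

Lemma ptree_cut m : self_pruned m -> inner (tr m) != fset0 ->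
  tr m.+1 = cut_below (tr m) (fun y => g y (tr m) == lam m.+1).
Proof.
move=> gm i0; rewrite ptreeS lambda_gmax //; apply: prune_gmax => //.
- exact: is_tree_ptree.
- by case: gm.
- exact: gmax_fin.
Qed.

Lemma inner_of_lambda m : lam m.+1 <> 0%E -> inner (tr m) != fset0.
Proof.
move=> l0; apply/eqP => i0; apply: l0; rewrite lambdaS.
by apply: next_level_root => //;
  [exact: is_tree_ptree|exact: lambda_ge0].
Qed.

Lemma ptree_card m : self_pruned m -> lam m.+1 <> 0%E -> (#|` tr m.+1| < #|` tr m|)%N.
Proof.
move=> gm /inner_of_lambda i0; rewrite ptree_cut //.
have [y yi gy] := gmax_attained P Y S i0.
apply: (cut_proper (is_tree_ptree m) yi); apply/eqP.
by rewrite gy lambda_gmax.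
Qed.

(** Each step at a nonzero level removes nodes. The count starts at [tr 1], since [self_pruned 0]
    may fail. *)
Lemma lambda_terminates : exists M, lam M.+1 = 0%E.
Proof.
suff h k : forall m, (0 < m)%N -> (#|` tr m| <= k)%N -> exists M, lam M.+1 = 0%E.
  exact: (h #|` tr 1| 1%N).
elim: k => [|k IH] m m0 mk; (have [e|ne] := pselect (lam m.+1 = 0%E); first by exists m).
  have gm : self_pruned m by case: m m0 {mk ne} => // m _; exact: self_prunedS.
  by have := leq_trans (ptree_card gm ne) mk; rewrite ltn0.
have gm : self_pruned m by case: m m0 {mk ne} => // m _; exact: self_prunedS.
by apply: (IH m.+1) => //; have := leq_trans (ptree_card gm ne) mk.
Qed.

Lemma lambda1_infty : ~ reduces_a K0 -> lam 1%N = +oo%E.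
Proof.
move=> nl; rewrite lambdaS; apply: next_level_infty => //.
exact: is_tree_complete.
Qed.

Lemma ptree1_smallest_optimal : ~ reduces_a K0 -> optimal_at P Y S +oo%E K0 (tr 1%N).
Proof. by move=> nl; rewrite -(lambda1_infty nl); exact: ptree_smallest_optimal. Qed.

Lemma tree_a_ge0 T : 0 <= ta T.
Proof. by apply: sumr_ge0 => y _; exact: cost_a_ge0. Qed.

Lemma tree_b_ge0 T : 0 <= tb T.
Proof. by apply: sumr_ge0 => y _; exact: cost_b_ge0. Qed.

Lemma tree_a_ptree1 : ~ reduces_a K0 -> ta (tr 1%N) = 0.
Proof.
move=> /ptree1_smallest_optimal [M hM]; apply/le_anti; rewrite tree_a_ge0 andbT leNgt.
apply/negP => a0; set a1 := ta _ in a0.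
(* Beyond the threshold [M] of optimality, and large enough for [r * a1] to exceed the cost of the
   complete tree, whose a is 0. *)
pose r := Num.max M (tb K0 / a1) + 1.
have rM : M < r by rewrite /r ltr_pwDr // le_max lexx.
have rb : tb K0 / a1 < r by rewrite /r ltr_pwDr // le_max lexx orbT.
have [_ /(_ K0)[]] := hM r rM.
  by split; [exact: is_tree_complete|exact: fsubset_refl].
rewrite !tree_JE (tree_a_complete Y_meas S_meas S_le) mulr0 addr0 leNgt => /negP h _.
apply: h; rewrite ltr_pdivrMr // in rb; apply: lt_le_trans rb _.
by rewrite lerDr tree_b_ge0.
Qed.

Lemma tree_a_at_complete y : ta (subtree_at K0 y) = 0.
Proof.
rewrite /tree_a; apply/eqP; rewrite -[X in X == _]/(leaf_sum _ _).
rewrite leaf_sum_subtree_at big_seq_cond big1 // => z /andP[zl _].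
by apply: (cost_a_kappa Y_meas S_meas S_le); rewrite (leaves_complete P Y zl).
Qed.

Lemma leaf_ptree1 : ~ reduces_a K0 ->
  forall y, y \in leaves (tr 1%N) -> cost_a P Y S y = 0.
Proof.
move=> nl y yl; have /eqP := tree_a_ptree1 nl.
rewrite /tree_a big_seq psumr_eq0 => [/allP /(_ y yl)|z _]; last exact: cost_a_ge0.
by rewrite yl => /eqP.
Qed.

Lemma inner_ptree1 y : y \in inner (tr 1%N) -> 0 < cost_a P Y S y.
Proof.
move=> yi; have [lT _] := self_prunedS 0; apply: lt_le_trans (lT y yi) _.
by rewrite gerBl tree_a_ge0.
Qed.

(** Given this past, S has occurred almost surely: splitting [z] raises b by the positive
    probability of the past and leaves a at 0. *)
Lemma g_settled z : (size z < kappa)%N -> 0 < pr P (past_is Y z) ->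
  cost_a P Y S z = 0 -> g z K0 = +oo%E.
Proof.
move=> zk F0 az; rewrite /g tree_a_at_complete az subrr.
have zT : z \in K0 by rewrite mem_complete_tree ltnW.
have zi : z \in inner K0 by rewrite (inner_complete _ _ (card_alphabet_gt0 P Y)).
suff h : 0 < tb (subtree_at K0 z) - cost_b P Y S z.
  by rewrite inve0 gt0_muley // lte_fin.
rewrite tree_bE leaf_sum_at //; last exact: is_tree_complete.
rewrite addrAC subrr add0r big_mkcond (bigD1_seq z) ?fset_uniq //= prefix_refl.
apply: ltr_pwDl; last by apply: sumr_ge0 => u _; case: ifP => // _; exact: b_incr.
rewrite increment_b //.
suff -> : pr P (past_is Y z `&` [set w | (S w <= size z)%N]) =
    pr P (past_is Y z) by [].
have mS1 := measurable_S S_meas (fun k => k <= size z)%N.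
have mS2 := measurable_S S_meas (fun k => size z < k)%N.
have mF := measurable_past Y_meas z.
rewrite [RHS](_ : _ = pr P ((past_is Y z `&` [set w | (S w <= size z)%N]) `|`
                           (past_is Y z `&` [set w | (size z < S w)%N]))).
  rewrite prU; try exact: measurableI.
    by rewrite -cost_aE // az addr0.
  by apply/seteqP; split=> w //= [[_ h1] [_]]; rewrite ltnNge h1.
congr (pr P _); rewrite -setIUr; apply/seteqP; split=> w; last by case.
by move=> Fw; split=> //=; case: (leqP (S w) (size z)) => h; [left|right].
Qed.

Lemma g_infty_a y : y \in K0 -> g y K0 = +oo%E -> cost_a P Y S y = 0.
Proof.
move=> yT gy; apply/eqP/negPn/negP => a0; move: gy.
have aL : 0 < cost_a P Y S y by rewrite lt_neqAle eq_sym a0 cost_a_ge0.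
by rewrite /g tree_a_at_complete subr0 inver (negbTE a0).
Qed.

(** A node with [cost_a] equal to 0 is either null, where [null_nodes_settled] supplies [z], or
    itself settled with positive probability. *)
Lemma settled_above y : null_nodes_settled P Y S kappa -> (size y < kappa)%N ->
  cost_a P Y S y = 0 -> exists z, [/\ prefix z y, z \in inner K0 & g z K0 = +oo%E].
Proof.
move=> settled yk ay.
have [z [zy F0 az]] : exists z, [/\ prefix z y, 0 < pr P (past_is Y z) &
    cost_a P Y S z = 0].
  have [/settled|F0] := eqVneq (pr P (past_is Y y)) 0; first exact.
  by exists y; rewrite prefix_refl lt_neqAle eq_sym F0 pr_ge0.
have zk : (size z < kappa)%N by apply: leq_ltn_trans yk; exact: size_prefix.
exists z; split=> //; last exact: g_settled.
by rewrite (inner_complete _ _ (card_alphabet_gt0 P Y)).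
Qed.

Lemma gmax_complete : ~ reduces_a K0 -> null_nodes_settled P Y S kappa -> gmax K0 = +oo%E.
Proof.
move=> nl settled.
have [y yi ay] : exists2 y, y \in inner K0 & cost_a P Y S y = 0.
  apply: contrapT => no; apply: nl => y yi.
  rewrite /a_excess tree_a_at_complete subr0 lt_neqAle (cost_a_ge0 P Y_meas S_meas) andbT.
  by apply/eqP => ay; apply: no; exists y.
have yk : (size y < kappa)%N by rewrite -(inner_complete _ _ (card_alphabet_gt0 P Y)).
have [z [_ zi gz]] := settled_above settled yk ay.
apply/eqP; rewrite -leye_eq -gz.
exact: (@le_bigmax_seq _ _ _ _ -oo%E z xpredT).
Qed.

(** In [tr 1], [cost_a] is positive at inner nodes and 0 at leaves. So [g] is never [+oo] at an
    inner node of [tr 1], whereas every leaf of [tr 1] that is inner in the complete tree lies at or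
    below a node with [g] equal to [+oo]. *)
Lemma ptree1_cut : ~ reduces_a K0 -> null_nodes_settled P Y S kappa ->
  tr 1%N = cut_below K0 (fun y => g y K0 == +oo%E).
Proof.
move=> nl settled; have hT := is_tree_ptree 1; have sT := fsubsetP (ptree_sub 1).
have hK := is_tree_complete (B := B) kappa.
apply/fsetP => z; apply/idP/in_cut => [zT|[zK hz]].
  split=> [|y yi /eqP gy yz]; first exact: sT.
  apply/eqP/negPn/negP => zy.
  have yi1 : y \in inner (tr 1%N) by apply: inner_prefix hT yz zT _; rewrite eq_sym.
  by have := inner_ptree1 yi1; rewrite g_infty_a ?ltxx //; exact: inner_in.
apply/negPn/negP => zT.
have [|y yl yz] := leaf_prefix_ex (s := z) hT; first by apply: contra zT; exact: inner_in.
have zy : y != z by apply: contra zT => /eqP <-; exact: leaves_in.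
have yi := inner_prefix hK yz zK zy.
have yk : (size y < kappa)%N by rewrite -(inner_complete _ _ (card_alphabet_gt0 P Y)).
have [u [uy ui /eqP gu]] := settled_above settled yk (leaf_ptree1 nl yl).
have e := hz u ui gu (prefix_trans uy yz).
have ez : size y = size z.
  by apply/eqP; rewrite eqn_leq (size_prefix yz) e (size_prefix uy).
by move: yz; rewrite prefixE ez take_size eq_sym (negbTE zy).
Qed.

Lemma smallest_optimal_sub_ptree m r U : 0 <= r -> (r%:E <= lam m)%E ->
  smallest_optimal P Y S r K0 U -> (U `<=` tr m)%fset.
Proof.
move=> r0; elim: m => [_ [[]]//|m IH] rl hU.
(* The levels do not increase along the sequence, so [r] lies below the earlier ones as well. *)
have rl' : (r%:E <= lam m)%E.
  apply: le_trans rl _; have [gm|ngm] := pselect (self_pruned m); last first.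
    by case: m ngm {IH} => [_|m []]; [exact: leey|exact: self_prunedS].
  have [/eqP i0|i0] := boolP (inner (tr m) == fset0); last first.
    by rewrite lambda_gmax // ltW //; case: gm.
  by rewrite lambdaS next_level_root ?lambda_ge0 //; exact: is_tree_ptree.
have h : optimal_at P Y S r%:E (tr m) U.
  by apply: smallest_optimal_restrict hU (ptree_sub0 m) (IH rl' hU).
exact: optimal_at_mono a_decr _ _ _ _ _ h (ptree_smallest_optimal m) rl.
Qed.

(* Optimality among the subtrees of the previous tree only is the definition of
   the sequence; monotonicity in the level makes it global. *)
Lemma ptree_optimal m r : 0 <= r -> self_pruned m -> (gmax (tr m) < r%:E)%E ->
  (r%:E <= lam m)%E -> smallest_optimal P Y S r K0 (tr m).
Proof.
move=> r0 [lT _] gr rl.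
have [U hU] := smallest_optimal_exists P Y S r (is_tree_complete (B := B) kappa).
suff <- : U = tr m by [].
apply: (@smallest_optimal_uniq _ _ _ _ P Y S r (tr m)).
  exact: smallest_optimal_restrict hU (ptree_sub0 m) (smallest_optimal_sub_ptree r0 rl hU).
have e := (prune_selfP a_decr b_incr (is_tree_ptree m) (l := r%:E) r0).2 (conj lT gr).
by have := prune_smallest_optimal a_decr (is_tree_ptree m) (l := r%:E) r0; rewrite e.
Qed.

End Sequence.

(** * The minimal delay and its break-points *)

Section PiecewiseAffine.
Context {R : realType}.
Implicit Types (f : R -> R).

Lemma affine_inside f x0 x1 c s z : x0 < z -> z < x1 ->
  (forall x, x0 <= x <= x1 -> f x = c - s * x) -> locally_affine_at f z.
Proof.
move=> x0z zx1 h; exists c, (- s).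
have o : nbhs z [set x | x0 < x < x1].
  have := @near_in_itvoo R x0 x1 z; rewrite in_itv /= x0z zx1 => /(_ isT).
  by apply: filterS => x; rewrite in_itv.
apply: filterS o => x /andP[a b].
by rewrite h ?mulNr // (ltW a) (ltW b).
Qed.

(** The second difference of [f] at [z] with a small step [k] is [(s - s') * k], while it is 0 for
    an affine function. *)
Lemma not_affine_at_kink f x0 x1 z c s c' s' : x0 < z -> z < x1 -> s' < s ->
  (forall x, x0 <= x <= z -> f x = c - s * x) ->
  (forall x, z <= x <= x1 -> f x = c' - s' * x) -> ~ locally_affine_at f z.
Proof.
move=> x0z zx1 ss h h' [p [q /nbhs_ballP[e /= e0 he]]].
pose k := Num.min (e / 2) (Num.min (z - x0) (x1 - z)).
have k0 : 0 < k by rewrite /k !lt_min !subr_gt0 x0z zx1 divr_gt0.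
have ke : k < e.
  by apply: (@le_lt_trans _ _ (e / 2)); [rewrite /k ge_min lexx|lra].
have kx0 : k <= z - x0 by rewrite /k !ge_min lexx orbT.
have kx1 : k <= x1 - z by rewrite /k !ge_min lexx !orbT.
have e1 : f (z - k) = p + q * (z - k).
  by apply: he; rewrite /ball /= opprB addrCA subrr addr0 gtr0_norm.
have e2 : f (z + k) = p + q * (z + k).
  by apply: he; rewrite /ball /= opprD addrA subrr add0r normrN gtr0_norm.
have e3 : f z = p + q * z by apply: he; exact: ballxx.
have zc : c - s * z = c' - s' * z.
  by rewrite -h ?(ltW x0z) ?lexx // h' // lexx ltW.
rewrite h in e1; last by apply/andP; split; lra.
rewrite h' in e2; last by apply/andP; split; lra.
rewrite h in e3; last by apply/andP; split; lra.
have : 0 < (s - s') * k by rewrite mulr_gt0 ?subr_gt0.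
by move: zc e1 e2 e3; lra.
Qed.

End PiecewiseAffine.

Section MinDelay.
Context {R : realType} {d : measure_display} {Omega : measurableType d}.
Context {A B : finType}.
Variables (P : probability Omega R).
Variables (X : nat -> Omega -> A) (Y : nat -> Omega -> B).
Variables (S : Omega -> nat) (kappa : nat).
Hypothesis X_meas : forall i x, measurable [set w | X i w = x].
Hypothesis Y_meas : forall i y, measurable [set w | Y i w = y].
Hypothesis S_meas : forall n, measurable [set w | S w = n].
Local Notation K0 := (complete_tree B kappa).
Local Notation ta := (tree_a P Y S).
Local Notation tb := (tree_b P Y S).
Local Notation tJ := (tree_J P Y S).
Local Notation D := (min_delay P X Y S kappa).

Lemma min_delay_eq (alpha v : R) : feasible P X Y S kappa alpha v ->
  (forall u, feasible P X Y S kappa alpha u -> v <= u) -> D alpha = v.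
Proof.
move=> fv lv; rewrite /min_delay; case: xgetP => [u _ [fu lu]|/(_ v)[]].
  by apply/le_anti; rewrite lv // lu.
by split=> // u; exact: lv.
Qed.

Lemma min_delay_segment (U1 U2 : tree B) (l x : R) : 0 <= l ->
  subtree U1 K0 -> subtree U2 K0 -> ta U1 < ta U2 -> tJ l U1 = tJ l U2 ->
  (forall U, subtree U K0 -> tJ l U2 <= tJ l U) ->
  ta U1 <= x <= ta U2 -> D x = tJ l U2 - l * x.
Proof.
move=> l0 [h1 s1] [h2 s2] lt12 eJ opt /andP[x1 x2].
(* The coin weight for which the mixture has P(T < S) equal to [x]. *)
pose t := (ta U2 - x) / (ta U2 - ta U1).
have D0 : 0 < ta U2 - ta U1 by rewrite subr_gt0.
have t01 : 0 <= t <= 1.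
  by rewrite /t divr_ge0 ?subr_ge0 ?(ltW lt12) //= ler_pdivrMr // mul1r lerD2l lerN2.
have tD : t * (ta U2 - ta U1) = ta U2 - x by rewrite /t divfK // gt_eqF.
have mix : t * ta U1 + (1 - t) * ta U2 = x by move: tD; lra.
have val : t * tb U1 + (1 - t) * tb U2 = tJ l U2 - l * x.
  have -> : t * tb U1 + (1 - t) * tb U2 =
      t * (tJ l U1 - l * ta U1) + (1 - t) * (tJ l U2 - l * ta U2).
    by rewrite !tree_JE !addrK.
  by rewrite eJ -mix; ring.
apply: min_delay_eq.
  rewrite -val; apply: feasible_mixed => //; by rewrite mix.
by move=> u fu; rewrite lerBlDr; exact: feasible_ge fu.
Qed.

Lemma min_delay_zero (U : tree B) (x : R) : subtree U K0 -> tb U = 0 ->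
  ta U <= x -> D x = 0.
Proof.
move=> [hU sU] b0 ax; apply: min_delay_eq; last by move=> u; exact: feasible_ge0.
(* A stopping time without randomization is the mixture of [U] with itself. *)
have := @feasible_mixed _ _ _ _ _ P X Y S kappa X_meas Y_meas S_meas 1 _ U U hU hU sU sU x.
rewrite subrr !mul0r !addr0 !mul1r b0; apply=> //.
by rewrite ler01 lexx.
Qed.

End MinDelay.

Section BreakPointsOfMinDelay.
Context {R : realType} {d : measure_display} {Omega : measurableType d}.
Context {A B : finType}.
Variables (P : probability Omega R).
Variables (X : nat -> Omega -> A) (Y : nat -> Omega -> B).
Variables (S : Omega -> nat) (kappa : nat).
Hypothesis X_meas : forall i x, measurable [set w | X i w = x].
Hypothesis Y_meas : forall i y, measurable [set w | Y i w = y].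
Hypothesis S_meas : forall n, measurable [set w | S w = n].
Hypothesis S_le : {ae P, forall w, (S w <= kappa)%N}.
Local Notation K0 := (complete_tree B kappa).
Local Notation ta := (tree_a P Y S).
Local Notation tb := (tree_b P Y S).
Local Notation tJ := (tree_J P Y S).
Local Notation D := (min_delay P X Y S kappa).
Local Notation lam := (lambda P Y S kappa).
Local Notation tr := (ptree P Y S kappa).
Local Notation self_pruned := (self_pruned P Y S kappa).
Local Notation reduces_a := (reduces_a P Y S).
Local Notation gmax := (gmax P Y S).
Local Notation slope m := (fine (lam m)).

Let a_decr := increment_a_le0 P Y_meas S_meas.
Let b_incr := increment_b_ge0 P Y_meas S_meas.

Lemma lambda_fin m : self_pruned m -> lam m.+1 \is a fin_num.
Proof.
move=> gm; have [e|ne] := pselect (lam m.+1 = 0%E); first by rewrite e.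
have i0 := inner_of_lambda Y_meas S_meas ne.
by rewrite (lambda_gmax Y_meas S_meas gm i0) (gmax_fin Y_meas S_meas gm i0).
Qed.

Lemma slope_ge0 m : 0 <= slope m.
Proof. by apply: fine_ge0; exact: lambda_ge0. Qed.

Lemma ptree_optimal_next m U : self_pruned m -> subtree U K0 ->
  tJ (slope m.+1) (tr m.+1) <= tJ (slope m.+1) U.
Proof.
move=> gm sU; have [_ gl] := self_prunedS P kappa Y_meas S_meas m.
have e := fineK (lambda_fin gm).
have [_ h] := @ptree_optimal _ _ _ _ P Y S kappa Y_meas S_meas m.+1 (slope m.+1)
  (slope_ge0 _) (self_prunedS P kappa Y_meas S_meas m)
  (eq_ind_r (fun z => (gmax (tr m.+1) < z)%E) gl e)
  (eq_ind_r (fun z => (z <= lam m.+1)%E) (lexx _) e).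
by have [] := h U sU.
Qed.

Lemma ptree_tie m : self_pruned m -> lam m.+1 <> 0%E ->
  tJ (slope m.+1) (tr m) = tJ (slope m.+1) (tr m.+1).
Proof.
move=> gm ne; apply/le_anti; rewrite [X in _ && X]ptree_optimal_next //; last exact: ptree_sub0.
rewrite andbT; have i0 := inner_of_lambda Y_meas S_meas ne.
have hT := is_tree_ptree P kappa Y_meas S_meas m.
apply: tree_J_le_sub => //.
  by split; [exact: is_tree_ptree|exact: ptree_subS].
move=> y yi; have [lT _] := gm.
have : (g P Y S y (tr m) <= lam m.+1)%E.
  rewrite (lambda_gmax Y_meas S_meas gm i0).
  exact: (@le_bigmax_seq _ _ _ _ -oo%E y xpredT).
by rewrite -{1}(fineK (lambda_fin gm)) g_reduces_a ?lT // lee_fin ler_pdivrMr ?lT.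
Qed.

(** If a were equal, the tie at [slope m.+1] would be a tie at every level. Just above [gmax (tr m)]
    the tree [tr m] is its own smallest optimal subtree, so it would be contained in the smaller
    [tr m.+1]. *)
Lemma ptree_a_lt m : self_pruned m -> lam m.+1 <> 0%E -> ta (tr m) < ta (tr m.+1).
Proof.
move=> gm ne; have hT := is_tree_ptree P kappa Y_meas S_meas m.
have hT1 := is_tree_ptree P kappa Y_meas S_meas m.+1.
have sT1 := ptree_subS P kappa Y_meas S_meas m.
rewrite lt_neqAle andbC (leaf_sum_anti a_decr hT hT1 sT1) /=.
apply/negP => /eqP ea; have := ptree_card Y_meas S_meas gm ne.
rewrite ltnNge => /negP; apply; apply: fsubset_leq_card.
have i0 := inner_of_lambda Y_meas S_meas ne.
pose r := slope m.+1 + 1.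
have r0 : 0 <= r by rewrite addr_ge0 // slope_ge0.
have [lT _] := gm.
have gr : (gmax (tr m) < r%:E)%E.
  rewrite -(lambda_gmax Y_meas S_meas gm i0) -(fineK (lambda_fin gm)) lte_fin.
  by rewrite /r ltrDl.
have e := (prune_selfP a_decr b_incr hT (l := r%:E) r0).2 (conj lT gr).
have := prune_smallest_optimal a_decr hT (l := r%:E) r0; rewrite e => -[_ /(_ (tr m.+1))[]].
  by split.
move=> _; apply; have := ptree_tie gm ne.
by rewrite !tree_JE ea => /addIr ->.
Qed.

Lemma min_delay_between m x : self_pruned m -> lam m.+1 <> 0%E ->
  ta (tr m) <= x <= ta (tr m.+1) ->
  D x = tJ (slope m.+1) (tr m.+1) - slope m.+1 * x.
Proof.
move=> gm ne; apply: min_delay_segment => //.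
- exact: slope_ge0.
- exact: ptree_sub0.
- exact: ptree_sub0.
- exact: ptree_a_lt.
- exact: ptree_tie.
- by move=> U; exact: ptree_optimal_next.
Qed.

(** At level 0 every [g] is at most 0, and the numerator of [g] at the root is the whole of [tb]. *)
Lemma tree_b_last m : self_pruned m -> lam m.+1 = 0%E -> tb (tr m) = 0.
Proof.
move=> gm e; have hT := is_tree_ptree P kappa Y_meas S_meas m.
have rT : [::] \in tr m by exact: tree_nil.
have [/eqP i0|i0] := boolP (inner (tr m) == fset0).
  rewrite tree_bE leaf_sumE // i0 big_seq big1 ?addr0 ?cost_b_nil //.
have ri : [::] \in inner (tr m).
  have [y yi _] := gmax_attained P Y S i0.
  by apply: inner_prefix_inner hT _ yi; exact: prefix0s.
have [lT _] := gm; have a0 := lT _ ri.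
have : (g P Y S [::] (tr m) <= 0)%E.
  rewrite -e (lambda_gmax Y_meas S_meas gm i0).
  exact: (@le_bigmax_seq _ _ _ _ -oo%E [::] xpredT).
rewrite g_reduces_a // lee_fin pmulr_lle0 ?invr_gt0 // /b_excess subtree_at_nil.
rewrite cost_b_nil // subr0 => h; apply/le_anti; rewrite h /=.
by apply: tree_b_ge0.
Qed.

(** The tree is optimal at some positive level, and both it and the tree of [exists_free_tree] have
    b equal to 0, so their costs compare their a. *)
Lemma tree_a_last m : self_pruned m -> lam m.+1 = 0%E -> (0 < lam m)%E -> ta (tr m) < 1.
Proof.
move=> gm e lpos; have [U [hU sU b0 a1]] := exists_free_tree Y_meas S_meas S_le.
apply: le_lt_trans a1.
(* Any positive finite level up to [lam m] would do; [lam m] may be infinite. *)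
pose r := if lam m == +oo%E then 1 else slope m.
have [r0 rl] : 0 < r /\ (r%:E <= lam m)%E.
  rewrite /r; case: ifPn => [/eqP ->|ny]; first by rewrite leey.
  have lf : lam m \is a fin_num by rewrite ge0_fin_numE ?ltey // lambda_ge0.
  by rewrite fineK // lexx -lte_fin fineK.
have gr : (gmax (tr m) < r%:E)%E.
  apply: (@le_lt_trans _ _ 0%E); last by rewrite lte_fin.
  have [/eqP i0|i0] := boolP (inner (tr m) == fset0).
    by rewrite gmax_root // leNye.
  by rewrite -(lambda_gmax Y_meas S_meas gm i0) e.
have [_ h] := ptree_optimal Y_meas S_meas (ltW r0) gm gr rl.
have [] := h U (conj hU sU).
by rewrite !tree_JE b0 tree_b_last // !add0r ler_pM2l.
Qed.

Lemma tree_a_ptree0 : ta (tr 0) = 0.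
Proof. exact: tree_a_complete. Qed.

Section Indexed.
Variable M : nat.
Hypothesis lamM : lam M.+1 = 0%E.
Hypothesis lam_lt : forall k, (k < M)%N -> lam k.+1 <> 0%E.

(* If the first pruning step takes place at the level +oo, the complete tree is
   not on the curve, which then starts with [tr 1] instead of [tr 0]. *)
Let m0 : nat := if pselect (reduces_a K0) then 0%N else 1%N.

Let good_m0 m : (m0 <= m)%N -> self_pruned m.
Proof.
case: m => [|m] h; last exact: self_prunedS.
by apply: self_pruned0; move: h; rewrite /m0; case: pselect.
Qed.

Let m0M : (m0 <= M)%N.
Proof.
rewrite /m0; case: pselect => // nl; rewrite lt0n; apply/eqP => M0.
by move: lamM; rewrite M0 (lambda1_infty Y_meas S_meas nl).
Qed.

Let a_m0 : ta (tr m0) = 0.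
Proof.
by rewrite /m0; case: pselect => nl; [exact: tree_a_ptree0|exact: tree_a_ptree1].
Qed.

Let a_mono m n : (m0 <= m)%N -> (m <= n)%N -> (n <= M)%N -> ta (tr m) <= ta (tr n).
Proof.
move=> hm; elim: n => [|n IH]; first by rewrite leqn0 => /eqP ->.
rewrite leq_eqVlt => /orP[/eqP -> //|mn] nM.
apply: le_trans (IH mn (ltnW nM)) (ltW (ptree_a_lt _ (lam_lt nM))).
exact/good_m0/(leq_trans hm).
Qed.

Let lam_pos : (0 < lam M)%E.
Proof.
rewrite lt_neqAle lambda_ge0 andbT eq_sym; apply/eqP.
by case: (M) lam_lt => [//|n] h; exact: h.
Qed.

Let a_lt1 m : (m0 <= m <= M)%N -> ta (tr m) < 1.
Proof.
move=> /andP[hm mM]; apply: le_lt_trans (a_mono hm mM (leqnn _)) _.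
by apply: tree_a_last => //; exact: good_m0.
Qed.

(** One form for the piece to the right of each vertex: the next segment, or for [m = M] the zero
    piece up to 1, whose slope is [lam M.+1 = 0]. *)
Let right_piece m : (m0 <= m <= M)%N -> exists c x1, [/\ ta (tr m) < x1,
  (m < M)%N -> x1 = ta (tr m.+1), (m = M -> x1 = 1) &
  forall x, ta (tr m) <= x <= x1 -> D x = c - slope m.+1 * x].
Proof.
move=> /andP[hm mM]; have gm := good_m0 hm.
move: mM; rewrite leq_eqVlt => /orP[/eqP eM|mM].
  exists 0, 1; split.
  - by apply: a_lt1; rewrite hm eM /=.
  - by rewrite eM ltnn.
  - by [].
  - move=> x /andP[ax _]; rewrite eM lamM /= mul0r subr0.
    apply: min_delay_zero ax => //; first exact: ptree_sub0.
    by apply: tree_b_last => //; rewrite eM.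
exists (tJ (slope m.+1) (tr m.+1)), (ta (tr m.+1)); split=> //.
- exact: ptree_a_lt gm (lam_lt mM).
- by move=> eM; move: mM; rewrite eM ltnn.
- by move=> x hx; exact: min_delay_between gm (lam_lt mM) hx.
Qed.

Let min_delay_at m : (m0 <= m <= M)%N -> D (ta (tr m)) = tb (tr m).
Proof.
move=> /andP[hm mM]; have gm := good_m0 hm.
move: mM; rewrite leq_eqVlt => /orP[/eqP eM|mM].
  rewrite tree_b_last ?eM //; last by rewrite -eM.
  apply: (min_delay_zero _ _ _ (U := tr M)) => //; first exact: ptree_sub0.
  by apply: tree_b_last => //; rewrite -eM.
have ne := lam_lt mM.
rewrite (min_delay_between gm ne) ?lexx ?(ltW (ptree_a_lt gm ne)) //.
by rewrite -(ptree_tie gm ne) tree_JE addrK.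
Qed.

(** Slopes drop strictly at each vertex inside the interval, which gives a kink. Conversely, every
    point of the interval lies on the piece starting at the last vertex before it, and is a kink
    only if it is that vertex. *)
Lemma break_points_min_delay :
  [set p | exists m, (1 <= m <= M)%N /\ p = (ta (tr m), tb (tr m))] =
  break_points D (lam 1%N).
Proof.
have m01 : (m0 <= 1)%N by rewrite /m0; case: pselect.
apply/seteqP; split=> [_ [m [/andP[m1 mM] ->]]|[x v] [/= ->]].
  have hm : (m0 <= m <= M)%N by rewrite mM (leq_trans m01).
  split=> /=; first by rewrite min_delay_at.
  case: m m1 mM hm => // m _ mM hm.
  have [mm0|] := leqP m0 m; last first.
    (* The vertex [tr 1] after a first step at [+oo]: it sits at abscissa 0, where the curve starts
       vertically. *)
    rewrite /m0; case: pselect => // nl; rewrite ltnS leqn0 => /eqP ->.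
    by right; rewrite (tree_a_ptree1 Y_meas S_meas S_le nl) (lambda1_infty Y_meas S_meas nl).
  have gm := good_m0 mm0; have ne := lam_lt mM; have alt := ptree_a_lt gm ne.
  left; split.
    by rewrite a_lt1 // andbT; apply: le_lt_trans alt; exact: tree_a_ge0.
  have [c [x1 [ax1 _ _ h]]] := right_piece hm.
  have [_ gl] := self_prunedS P kappa Y_meas S_meas m.
  apply: (not_affine_at_kink alt ax1 _ (fun x hx => min_delay_between gm ne hx) h).
  rewrite -lte_fin !fineK ?lambda_fin //; last exact: self_prunedS.
  have [e|ne'] := pselect (lam m.+2 = 0%E).
    by rewrite e lt_neqAle lambda_ge0 // andbT eq_sym; apply/eqP.
  have i0 := inner_of_lambda Y_meas S_meas ne'.
  by rewrite (lambda_gmax Y_meas S_meas (self_prunedS P kappa Y_meas S_meas m) i0).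
case=> [[/andP[x0 x1] na]|[-> e]].
  (* The largest such index gives the piece that contains [x]. *)
  pose Q m := (m0 <= m <= M)%N && (ta (tr m) <= x).
  have exQ : exists m, Q m by exists m0; rewrite /Q leqnn m0M a_m0 ltW.
  have ubQ m : Q m -> (m <= M)%N by move=> /andP[/andP[]].
  case: (ex_maxnP exQ ubQ) => m /andP[hm ax] mmax.
  have [hm0 mM] := andP hm.
  have [c [xr [axr eS eM h]]] := right_piece hm.
  have xxr : x < xr.
    move: mM; rewrite leq_eqVlt => /orP[/eqP /eM -> //|mM].
    rewrite (eS mM) ltNge; apply/negP => ax'.
    have : Q m.+1 by rewrite /Q (leq_trans hm0 (leqnSn m)) mM.
    by move=> /mmax; rewrite ltnn.
  move: ax; rewrite le_eqVlt => /orP[/eqP ax|ax]; last first.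
    by case: na; exact: affine_inside ax xxr h.
  exists m; split; last by rewrite -ax min_delay_at.
  (* The complete tree sits at abscissa 0, whereas [x] is positive. *)
  rewrite mM andbT lt0n; apply/eqP => e0.
  by move: x0; rewrite -ax e0 tree_a_ptree0 ltxx.
have nl : ~ reduces_a K0.
  move=> /(self_pruned0 (kappa := kappa)) g0; have := lambda_fin g0; rewrite e.
  by [].
have e1 : m0 = 1%N by rewrite /m0; case: pselect.
have M1 : (1 <= M)%N by rewrite -e1.
exists 1%N; split; first by rewrite M1.
by rewrite -a_m0 e1 min_delay_at // e1 M1.
Qed.

End Indexed.

End BreakPointsOfMinDelay.

Theorem corollary5 (R : realType) (d : measure_display)
    (Omega : measurableType d) (P : probability Omega R) (A B : finType)
    (X : nat -> Omega -> A) (Y : nat -> Omega -> B)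
    (S : Omega -> nat) (kappa : nat)
    (X_meas : forall i x, measurable [set w | X i w = x])
    (Y_meas : forall i y, measurable [set w | Y i w = y])
    (kappa_ge1 : (1 <= kappa)%N)
    (S_pos : forall w, (0 < S w)%N)
    (S_le : {ae P, forall w, (S w <= kappa)%N})
    (S_stop : stopping_time P X set0 S) :
  let lam := lambda P Y S kappa in
  let tr := ptree P Y S kappa in
  let G := g P Y S in
  let alpha m := early P (tree_stop Y (tr m)) S in
  let delta m := delay P (tree_stop Y (tr m)) S in
  exists M : nat,
    [/\ lam M.+1 = 0%E /\ (forall k, (k < M)%N -> lam k.+1 <> 0%E),
        forall m, (1 <= m <= M)%N ->
          (m = 1%N -> null_nodes_settled P Y S kappa) ->
          lam m = \big[maxe/-oo%E]_(y <- inner (tr m.-1)) G y (tr m.-1) /\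
          tr m = (tr m.-1 `\`
            \bigcup_(y <- inner (tr m.-1) | G y (tr m.-1) == lam m)
              descendants (tr m.-1) y)%fset
      & [set p | exists m, (1 <= m <= M)%N /\ p = (alpha m, delta m)] =
        break_points (min_delay P X Y S kappa) (lam 1%N)].
Proof.
move=> lam tr G alpha delta.
have S_meas : forall n, measurable [set w | S w = n] := S_stop.1.
have exM : exists M, `[< lam M.+1 = 0%E >].
  by have [M hM] := lambda_terminates P kappa Y_meas S_meas; exists M; exact/asboolP.
have [M /asboolP lamM Mmin] := ex_minnP exM.
have lam_lt k : (k < M)%N -> lam k.+1 <> 0%E.
  by move=> kM /asboolP /Mmin; rewrite leqNgt kM.
exists M; split=> //.
- case=> // m /andP[_ mM] settled /=; have ne := lam_lt m mM.
  have i0 := inner_of_lambda Y_meas S_meas ne.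
  have [gm|ngm] := pselect (self_pruned P Y S kappa m).
    split; first exact: lambda_gmax.
    exact: ptree_cut.
  (* Self-pruning can fail only at the complete tree, which is where [null_nodes_settled] is
     available. *)
  have m0 : m = 0%N by case: m ngm {mM settled ne i0} => // m []; exact: self_prunedS.
  rewrite m0 in settled *; have nl : ~ reduces_a P Y S (complete_tree B kappa).
    by move=> /(self_pruned0 (kappa := kappa)); rewrite -m0.
  have e1 := lambda1_infty Y_meas S_meas nl.
  rewrite /tr /lam e1; split.
    by rewrite -[RHS]/(gmax P Y S (complete_tree B kappa)) gmax_complete //; exact: settled.
  by apply: ptree1_cut => //; exact: settled.
- rewrite -(break_points_min_delay X_meas Y_meas S_meas S_le lamM lam_lt).
  have e m : (alpha m, delta m) = (tree_a P Y S (tr m), tree_b P Y S (tr m)).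
    rewrite /alpha /delta early_tree_stop //; last exact: is_tree_ptree.
    congr pair; apply: (delay_tree_stop P Y_meas S_meas); last exact: ptree_sub.
    exact: is_tree_ptree.
  by apply/seteqP; split=> p [m [hm ->]]; exists m; split=> //; rewrite e.
Qed.
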